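(* Let $K$ be a simplicial complex on $[m]$ and, for $i\in[m]$, let $L_i$ be a subcomplex of a simplex $\Delta^{l_i}$. Let $K(L_1,\dots,L_m)$ be the simplicial composition. There is an isomorphism of $\mathcal A$-modules $$\widetilde H^*(K(L_1,\dots,L_m))\;\cong\;\Sigma^m\,\widetilde H^*(K)\otimes\widetilde H^*(L_1)\otimes\cdots\otimes\widetilde H^*(L_m).$$
   Context: $\widetilde H^*(-)$ denotes reduced cohomology with $\mathbb F_2$ coefficients (of the geometric realization, for simplicial complexes) and $\mathcal A$ is the mod 2 Steenrod algebra, acting on tensor products via the Cartan formula. For a graded module $M$, $(\Sigma M)^n=M^{n-1}$. Simplicial complexes contain $\emptyset$; $K$ on $[m]=\{1,\dots,m\}$ has vertices labelled by $[m]$. The polyhedral join of pairs of simplicial complexes $(X_i,A_i)_{i=1}^m$ over $K$ is $(\underline X,\underline A)^{*K}=\bigcup_{\sigma\in K}Y_1^\sigma*\cdots*Y_m^\sigma\subseteq X_1*\cdots*X_m$, where $*$ is the join and $Y_i^\sigma=X_i$ if $i\in\sigma$, $Y_i^\sigma=A_i$ if $i\notin\sigma$. The simplicial composition is $K(L_1,\dots,L_m)=(\Delta^{l_i},L_i)^{*K}$, i.e. the polyhedral join of the pairs $(\Delta^{l_1},L_1),\dots,(\Delta^{l_m},L_m)$ over $K$, where $\Delta^{l_i}$ is the full simplex of dimension $l_i$. *)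

(* Defs.v *)
From HB Require Import structures.
From mathcomp Require Import all_boot all_order all_algebra.

Set Implicit Arguments.
Unset Strict Implicit.
Unset Printing Implicit Defensive.

Import GRing.Theory.
Local Open Scope ring_scope.

(** * Simplicial complexes, polyhedral joins *)

(* Finite abstract simplicial complexes whose vertices are labelled by [T].
   Every complex contains the empty simplex; an element of [T] need not be a
   vertex. *)
Record complex (T : finType) := Complex {
  faces :> {set {set T}};
  complex0 : set0 \in faces;
  complexS : forall s t : {set T}, t \subset s -> s \in faces -> t \in faces
}.

Section FullSimplex.
Variable T : finType.

Fact simplex0 : set0 \in [set: {set T}]. Proof. by rewrite inE. Qed.
Fact simplexS (s t : {set T}) :
  t \subset s -> s \in [set: {set T}] -> t \in [set: {set T}].
Proof. by rewrite !inE. Qed.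

Definition simplex : complex T := Complex simplex0 simplexS.
End FullSimplex.

Section PolyhedralJoin.
Variables (m : nat) (T : 'I_m -> finType).

(* The vertices of an m-fold join are the elements of the disjoint union
   [{i : 'I_m & T i}]; [slice s i] is the part of [s] lying in [T i]. *)
Definition slice (s : {set {i : 'I_m & T i}}) (i : 'I_m) : {set T i} :=
  [set x | Tagged T x \in s].

Definition join_faces (Y : forall i, complex (T i)) :
    {set {set {i : 'I_m & T i}}} :=
  [set s | [forall i, slice s i \in Y i]].

Variables (K : complex 'I_m) (X A : forall i, complex (T i)).

Definition polyjoin_faces : {set {set {i : 'I_m & T i}}} :=
  \bigcup_(s in K) join_faces (fun i => if i \in s then X i else A i).

Fact polyjoin0 : set0 \in polyjoin_faces.
Proof.
apply/bigcupP; exists set0; first exact: complex0.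
rewrite inE; apply/forallP => i; rewrite in_set0.
have -> : slice set0 i = set0 by apply/setP => x; rewrite !inE.
exact: complex0.
Qed.

Fact polyjoinS (s t : {set {i : 'I_m & T i}}) :
  t \subset s -> s \in polyjoin_faces -> t \in polyjoin_faces.
Proof.
move=> /subsetP ts /bigcupP[r rK]; rewrite inE => /forallP sY.
apply/bigcupP; exists r => //; rewrite inE; apply/forallP => i.
apply: complexS (sY i); apply/subsetP => x; rewrite !inE; exact: ts.
Qed.

Definition polyjoin : complex {i : 'I_m & T i} := Complex polyjoin0 polyjoinS.
End PolyhedralJoin.

Definition composition (m : nat) (K : complex 'I_m) (l : 'I_m -> nat)
    (L : forall i, complex 'I_(l i).+1) : complex {i : 'I_m & 'I_(l i).+1} :=
  polyjoin K (fun i => simplex 'I_(l i).+1) L.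

(** * Graded [F_2]-vector spaces with Steenrod operations *)

(* A graded module over the mod 2 Steenrod algebra is given by its total space,
   by the predicate [homog n] defining its subspace of elements of degree [n],
   and by the action of the algebra generators Sq^k. *)
Record sqModule := SqModule {
  total :> vectType 'F_2;
  homog : int -> total -> Prop;
  Sq : nat -> total -> total
}.

(* Since the Sq^k generate the Steenrod algebra, a linear map commuting with all
   of them is linear over the Steenrod algebra. *)
Definition steenrod_iso (M N : sqModule) : Prop :=
  exists phi : 'Hom(M, N),
    [/\ bijective phi,
        forall (n : int) (x : M), homog n x <-> homog n (phi x)
      & forall (k : nat) (x : M), phi (Sq k x) = Sq k (phi x)].

Definition susp (M : sqModule) : sqModule :=
  SqModule (fun n (x : M) => homog (n - 1) x) (fun k (x : M) => Sq k x).

Section TensorSpace.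
Variables V W : vectType 'F_2.

Let bV := vbasis {:V}.
Let bW := vbasis {:W}.

(* The tensor product of V and W, in coordinates with respect to the product of
   the library's bases of V and W. *)
Definition tens_space : vectType 'F_2 := 'M['F_2]_(\dim {:V}, \dim {:W}).

Definition pure (v : V) (w : W) : tens_space :=
  \matrix_(i, j) (coord bV i v * coord bW j w).

Definition tens_lift (U : vectType 'F_2) (h : V -> W -> U) (t : tens_space) : U :=
  \sum_i \sum_j t i j *: h bV`_i bW`_j.

Lemma tens_lift_pure (U : vectType 'F_2) (h : V -> W -> U) :
    (forall w, linear (h^~ w)) -> (forall v, linear (h v)) ->
  forall v w, tens_lift h (pure v w) = h v w.
Proof.
move=> hl hr v w; rewrite /tens_lift.
pose H1 w := GRing.isLinear.Build _ _ _ _ (h^~ w) (hl w).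
pose H2 v := GRing.isLinear.Build _ _ _ _ (h v) (hr v).
pose h1 w : {linear V -> U} := HB.pack (h^~ w) (H1 w).
pose h2 v : {linear W -> U} := HB.pack (h v) (H2 v).
have {2}-> : v = \sum_i coord bV i v *: bV`_i by apply/coord_vbasis/memvf.
rewrite -[RHS]/(h1 w _) linear_sum; apply: eq_bigr => i _.
rewrite linearZ /= -[h _ w]/(h2 bV`_i w).
have {2}-> : w = \sum_j coord bW j w *: bW`_j by apply/coord_vbasis/memvf.
rewrite linear_sum scaler_sumr; apply: eq_bigr => j _.
by rewrite mxE linearZ /= scalerA.
Qed.

Lemma tens_span (t : tens_space) :
  t = \sum_i \sum_j t i j *: pure bV`_i bW`_j.
Proof.
apply/matrixP => i j; rewrite summxE (bigD1 i) //= summxE (bigD1 j) //=.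
have cV (a b : 'I_(\dim {:V})) : coord bV a bV`_b = (b == a)%:R.
  exact: coord_free (basis_free (vbasisP _)).
have cW (a b : 'I_(\dim {:W})) : coord bW a bW`_b = (b == a)%:R.
  exact: coord_free (basis_free (vbasisP _)).
rewrite !mxE cV cW !eqxx !mulr1 big1 => [|j' nj]; last first.
  by rewrite !mxE cV cW (negPf nj) !mulr0.
rewrite addr0 big1 ?addr0 // => i' ni; rewrite summxE big1 // => j' _.
by rewrite !mxE cV (negPf ni) mul0r mulr0.
Qed.
End TensorSpace.

(* Elements of degree n are the sums of products of elements of degrees a and b
   with a + b = n; the Steenrod operations act by the Cartan formula, extended
   linearly. *)
Definition tens (M N : sqModule) : sqModule :=
  @SqModule (tens_space M N)
    (fun n t => exists2 s : seq (M * N), t = \sum_(p <- s) pure p.1 p.2 &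
       forall p, p \in s ->
         exists a b : int, [/\ a + b = n, homog a p.1 & homog b p.2])
    (fun k => tens_lift (fun (x : M) (y : N) =>
       \sum_(i < k.+1) pure (Sq i x) (Sq (k - i) y))).

(** * Reduced cohomology and its Steenrod operations *)

Section Cohomology.
Variables (T : finType) (K : complex T).

Definition face : finType := {s : {set T} | s \in faces K}.

(* Augmented cochains of all degrees: a face with c vertices is in degree
   c - 1, so the empty face is in degree -1. *)
Definition cochain : vectType 'F_2 := {ffun face -> ('F_2)^o}.

Definition value (f : cochain) (s : {set T}) : 'F_2 :=
  if insub s is Some s' then f s' else 0.

Definition cobound (f : cochain) : cochain :=
  [ffun s : face => \sum_(v in val s) value f (val s :\ v)].

Fact cobound_is_linear : linear cobound.
Proof.
move=> a f g; apply/ffunP => s; rewrite !ffunE scaler_sumr -big_split /=.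
apply: eq_bigr => v _; rewrite /value; case: insubP => [u _ _|_].
  by rewrite !ffunE.
by rewrite scaler0 addr0.
Qed.

Definition cocycles : {vspace cochain} := lker (linfun cobound).
Definition coboundaries : {vspace cochain} := limg (linfun cobound).

(* The quotient of [cocycles] by [coboundaries] is realized on a complement of
   [coboundaries] in [cocycles]: by [coh_class_surj] and [coh_class_eq],
   [coh_class] is a surjection from [cocycles] with kernel [coboundaries]. *)
Definition coh_space : vectType 'F_2 := subvs_of (cocycles :\: coboundaries).

Definition coh_class (f : cochain) : coh_space :=
  vsproj (cocycles :\: coboundaries) (addv_pi1 cocycles coboundaries f).

Definition of_degree (n : int) (f : cochain) : Prop :=
  forall s : face, f s != 0 -> #|val s|%:Z = n + 1.

Definition component (p : nat) (f : cochain) : cochain :=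
  [ffun s : face => if #|val s| == p.+1 then f s else 0].

(* [rank s v] is the 0-based position of v among the elements of s, ordered as
   in the enumeration of T. *)
Definition rank (s : {set T}) (v : T) : nat := index v (enum s).

(* Steenrod's cup-i product of cochains, as the sum over the subsets
   U = {u_1 < ... < u_(d-i)} of the d-simplex s of
     f (s \ U^0) g (s \ U^1),
   where u_j is in U^0 or U^1 according to the parity of j plus the position of
   u_j in s. For i = 0 this is the Alexander-Whitney formula. *)
Definition cup (i : nat) (f g : cochain) : cochain :=
  [ffun s : face =>
    \sum_(U : {set T} | (U \subset val s) && (#|U| + i.+1 == #|val s|)%N)
      let U0 := [set u in U | ~~ odd (rank U u + rank (val s) u)] in
      let U1 := [set u in U | odd (rank U u + rank (val s) u)] in
      value f (val s :\: U0) * value g (val s :\: U1)].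

(* Sq^0 is the identity and, for k > 0, Sq^k is x |-> x cup_(p - k) x in degree
   p >= k and is zero in degrees p < k. *)
Definition cochain_Sq (k : nat) (f : cochain) : cochain :=
  if k is 0 then f else
  \sum_(k <= p < #|T|) cup (p - k) (component p f) (component p f).

Definition redcoh : sqModule :=
  @SqModule coh_space
    (fun n x => exists f, [/\ f \in cocycles, of_degree n f & x = coh_class f])
    (fun k x => coh_class (cochain_Sq k (vsval x))).

End Cohomology.

Section CohomologyTheory.
Variables (T : finType) (K : complex T).
Implicit Types f g : cochain K.

HB.instance Definition _ :=
  GRing.isLinear.Build _ _ _ _ (@cobound T K) (@cobound_is_linear T K).

Lemma value_out f (s : {set T}) : s \notin faces K -> value f s = 0.
Proof. by rewrite /value => sK; rewrite insubN. Qed.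

Lemma value_face f (s : face K) : value f (val s) = f s.
Proof. by rewrite /value valK. Qed.

Lemma value_cobound f (s : {set T}) : s \in faces K ->
  value (cobound f) s = \sum_(v in s) value f (s :\ v).
Proof. by move=> sK; rewrite -[s]/(val (Sub s sK : face K)) value_face ffunE. Qed.

Lemma coboundK f : cobound (cobound f) = 0.
Proof.
apply/ffunP => s; rewrite !ffunE; case: s => s sK /=.
pose g v w := value f (s :\ v :\ w).
have gC v w : g v w = g w v.
  by rewrite /g; congr value; apply/setP => x; rewrite !inE andbCA.
transitivity (\sum_(v in s) \sum_(w in s | w != v) g v w).
  apply: eq_bigr => v _; rewrite value_cobound.
    by apply: eq_bigl => w; rewrite !inE andbC.
  exact: complexS (subsetDl _ _) sK.
pose lt (v w : T) := (enum_rank v < enum_rank w)%N.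
transitivity (\sum_(v in s) \sum_(w in s | lt v w) g v w +
              \sum_(v in s) \sum_(w in s | lt w v) g v w).
  rewrite -big_split; apply: eq_bigr => v _ /=.
  rewrite (bigID (lt v)) /=; congr (_ + _); apply: eq_bigl => w;
    case: (w \in s) => //=; rewrite -(inj_eq enum_rank_inj) -val_eqE /= /lt;
    by case: ltngtP.
rewrite [X in _ + X](exchange_big_dep (mem s)) //=; last by move=> v w _ /andP[].
rewrite -big_split big1 // => v vs /=.
rewrite [X in _ + X](_ : _ = \sum_(w in s | lt v w) g v w).
  exact: (addrr_pchar2 (pchar_Fp (isT : prime 2))).
apply: eq_big => [w|w _]; last exact: gC.
by rewrite vs.
Qed.

Lemma coboundaries_sub : (coboundaries K <= cocycles K)%VS.
Proof.
apply/subvP => _ /memv_imgP[f _ ->].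
by rewrite memv_ker !lfunE /= coboundK.
Qed.

Lemma coh_class_surj (x : coh_space K) :
  exists2 f, f \in cocycles K & coh_class f = x.
Proof.
have xZ := subvP (diffvSl (cocycles K) (coboundaries K)) _ (subvsP x).
exists (vsval x) => //; apply: subvs_inj; rewrite vsprojK.
  by rewrite daddv_pi_id ?capv_diff ?subvsP.
exact: memv_pi.
Qed.

Lemma coh_class_eq f g : f \in cocycles K -> g \in cocycles K ->
  (coh_class f == coh_class g) = (f - g \in coboundaries K).
Proof.
move=> fZ gZ; rewrite -subr_eq0 /coh_class -!linearB /= -(inj_eq subvs_inj).
set h := f - g; rewrite linear0 vsprojK ?memv_pi //.
have hZ : h \in (cocycles K + coboundaries K)%VS.
  by rewrite (addv_idPl coboundaries_sub) rpredB.
have hE := addv_pi1_pi2 hZ; apply/eqP/idP => [h0|hB].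
  by rewrite -hE h0 add0r memv_pi2.
by move: hE; rewrite addv_pi2_id // => /(canRL (addrK _)); rewrite subrr.
Qed.
End CohomologyTheory.

(* Main.v *)
Require Import Defs.
From Stdlib Require Import Ring Bool.
From HB Require Import structures.
From mathcomp Require Import all_boot all_order all_algebra.

Set Implicit Arguments.
Unset Strict Implicit.
Unset Printing Implicit Defensive.

Import GRing.Theory.
Local Open Scope ring_scope.

(* Cochains are evaluated on increasing lists of vertices. Replacing one vertex v
   of K by L, cochains f of L (extended by zero to the simplex) and g of K give
   the cochain Phi f g with
     Phi f g (a t n) = f(t) g(a n) + (df)(t) g(a v n),
   where t is the part of the simplex in the new block. Since d(Phi f g) is
   Phi f (dg), this induces a map of degree 1 from H(K) (x) H(L) to the cohomology
   of the new complex. It is bijective because the pair (simplex, L) contracts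
   onto the cone over H(L). Steenrod's cup-i products are multiplicative on
   joins, and an explicit homotopy turns this into the Cartan formula for Phi f g.
   The vertices of K are replaced one after the other. *)

(** * Coboundary and cup-i products of list functions *)

(** The term f(t) g(a n) alone does not commute with coboundaries, because a cocycle f of L is
    closed only on L. On the rest of the simplex df represents the image of f under the connecting
    homomorphism of the pair (simplex, L); blocks t outside L occur in a face only if a v n is a
    face of K. This alternative, t in L where df vanishes or a v n in K where g is closed, lies
    behind the vanishing arguments. The degree shift comes from the empty face having degree -1:
    numbers of vertices add up, so degrees add up to one less than the total. For the Cartan formula
    one has to work with cochains, since the squares are defined by cup-i products, and these are
    not commutative: an odd number of shared vertices in the block interchanges the two cochains on
    the remaining vertices. The homotopy is therefore built for two cochains g and h, although only
    g = h is used in the end: splitting off a vertex of a turns equal arguments into different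
    ones. *)

Section Lists.
Variable T : eqType.

Lemma filter_none (a : pred T) s : all (predC a) s -> filter a s = [::].
Proof. by rewrite all_predC has_filter negbK => /eqP. Qed.

Lemma filterC_none (a : pred T) s : all a s -> filter (predC a) s = [::].
Proof.
move=> aS; apply: filter_none; rewrite (eq_all (a2 := a)) // => x /=.
exact: negbK.
Qed.

(* Cochains are represented by functions on the increasing lists of vertices of
   the simplices; [ld] is then the simplicial coboundary. *)
Definition sh (M : Type) (x : T) (X : seq T -> M) : seq T -> M :=
  fun u => X (x :: u).

Fixpoint ld (M : nmodType) (X : seq T -> M) (u : seq T) : M :=
  if u is x :: u' then X u' + ld (sh x X) u' else 0.

Lemma ld_ext (M : nmodType) (X Y : seq T -> M) u :
  (forall w, subseq w u -> X w = Y w) -> ld X u = ld Y u.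
Proof.
elim: u X Y => //= x u IH X Y XY; congr (_ + _).
  by apply: XY; apply: subseq_cons.
by apply: IH => w wu; apply: XY; rewrite /= eqxx.
Qed.

Lemma ldD (M : nmodType) (X Y : seq T -> M) u :
  ld (fun w => X w + Y w) u = ld X u + ld Y u.
Proof.
elim: u X Y => [|x u IH] X Y /=; first by rewrite addr0.
by rewrite [ld _ u](IH (sh x X) (sh x Y)) addrACA.
Qed.

Lemma ld_morph (M N : nmodType) (f : M -> N) (X : seq T -> M) u :
  f 0 = 0 -> {morph f : x y / x + y} -> ld (fun w => f (X w)) u = f (ld X u).
Proof. by move=> f0 fD; elim: u X => [|x u IH] X //=; rewrite fD -IH. Qed.

Lemma ld_additive (M N : nmodType) (f : {additive M -> N}) (X : seq T -> M) u :
  ld (fun w => f (X w)) u = f (ld X u).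
Proof. by apply: ld_morph; [apply: raddf0 | apply: raddfD]. Qed.

Lemma ld0 (M : nmodType) u : ld (fun=> 0 : M) u = 0.
Proof. by elim: u => //= x u IH; rewrite [ld _ u]IH addr0. Qed.

Lemma ldK (M : nmodType) (X : seq T -> M) u :
  (forall m : M, m + m = 0) -> ld (ld X) u = 0.
Proof.
move=> M2; elim: u X => //= x u IH X.
by rewrite [ld (sh x _) u](ldD X (ld (sh x X))) addrA M2 add0r.
Qed.

Section Ring.
Variables (R : comNzRingType) (y : R).
Hypothesis two0 : 2%:R = 0 :> R.

Let radd (a b : R) : R := a + b.
Let rmul (a b : R) : R := a * b.
Let ropp (a : R) : R := a.
Let rzero : R := 0.
Let rone : R := 1.
Let ofbool (b : bool) : R := if b then 1 else 0.

Fact addrr2 (a : R) : a + a = 0.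
Proof. by rewrite -mulr2n -mulr_natr two0 mulr0. Qed.

Fact ring_theory2 : ring_theory rzero rone radd rmul radd ropp eq.
Proof.
split; rewrite /rzero /rone /radd /rmul /ropp //.
- exact: add0r.
- exact: addrC.
- exact: addrA.
- exact: mul1r.
- exact: mulrC.
- exact: mulrA.
- exact: mulrDl.
- exact: addrr2.
Qed.

Fact ring_morph2 : ring_morph rzero rone radd rmul radd ropp eq
  false true xorb andb xorb id Bool.eqb ofbool.
Proof.
split=> //; rewrite /ofbool /radd /rzero /rone /rmul.
- by do 2!case; rewrite /= ?addr0 ?add0r ?addrr2.
- by do 2!case; rewrite /= ?addr0 ?add0r ?addrr2.
- by do 2!case; rewrite /= ?mulr0 ?mul1r ?mul0r.
- by do 2!case.
Qed.

(* Declaring [bool] as the coefficients makes [ring] decide identities of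
   characteristic 2. *)
Add Ring Ring2 : ring_theory2 (morphism ring_morph2).

Ltac reify2 t := lazymatch t with
  | ?a + ?b => let a' := reify2 a in let b' := reify2 b in constr:(radd a' b')
  | ?a * ?b => let a' := reify2 a in let b' := reify2 b in constr:(rmul a' b')
  | 0 => constr:(rzero) | 1 => constr:(rone) | _ => constr:(t) end.
Ltac ring2 := match goal with |- @eq _ ?a ?b =>
  let a' := reify2 a in let b' := reify2 b in change (@eq R a' b'); ring end.

Implicit Types F G X Y P Q : seq T -> R.

Lemma ldZ (c : R) X u : ld (fun w => c * X w) u = c * ld X u.
Proof.
elim: u X => [|x u IH] X /=; first by rewrite mulr0.
by rewrite [ld _ u](IH (sh x X)) mulrDr.
Qed.

Definition wt (b : bool) : R := if b then 1 else y.

(* The generating function [\sum_n (F \cup_(n-1) G) X^n] of Steenrod's cup-i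
   products is [cc false F G + X * cc true F G], where [y] stands for [X ^ 2].
   The recursion splits off the first vertex: on a join, the second factors are
   interchanged when the product of the first ones has odd exponent; the
   convention [(F \cup_(-1) G) s = F set0 * G s] makes this uniform. *)
Fixpoint cc (b : bool) F G (u : seq T) : R :=
  if u is x :: u' then
    cc b F (sh x G) u' + wt b * cc (~~ b) (sh x G) (sh x F) u'
  else if b then 0 else F [::] * G [::].

Lemma cc_ext b F F' G G' u :
    (forall w, subseq w u -> F w = F' w) ->
    (forall w, subseq w u -> G w = G' w) ->
  cc b F G u = cc b F' G' u.
Proof.
elim: u b F F' G G' => [|x u IH] b F F' G G' eF eG /=; first by rewrite eF ?eG.
have sF w : subseq w u -> sh x F w = sh x F' w.
  by move=> wu; apply: eF; rewrite /= eqxx.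
have sG w : subseq w u -> sh x G w = sh x G' w.
  by move=> wu; apply: eG; rewrite /= eqxx.
congr (_ + _ * _); apply: IH => // w wu.
by apply: eF; apply: subseq_trans wu (subseq_cons _ _).
Qed.

(** Proved jointly with [ccDr], because the second term of the recursion interchanges the
    arguments. *)
Lemma ccDl b F F' G u :
  cc b (fun w => F w + F' w) G u = cc b F G u + cc b F' G u
with ccDr b F G G' u :
  cc b F (fun w => G w + G' w) u = cc b F G u + cc b F G' u.
Proof.
- case: u => [|x u] /=; first by case: b; rewrite ?addr0 ?mulrDl.
  rewrite ccDl [cc (~~ b) _ (sh x _) u](ccDr _ (sh x G) (sh x F) (sh x F')).
  by ring2.
- case: u => [|x u] /=; first by case: b; rewrite ?addr0 ?mulrDr.
  rewrite [cc b F (sh x _) u](ccDr _ F (sh x G) (sh x G')).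
  by rewrite [cc (~~ b) (sh x _) _ u](ccDl _ (sh x G) (sh x G')); ring2.
Qed.

Lemma cc0l b F G u : (forall w, subseq w u -> F w = 0) -> cc b F G u = 0
with cc0r b F G u : (forall w, subseq w u -> G w = 0) -> cc b F G u = 0.
Proof.
- case: u => [|x u] F0 /=; first by case: b; rewrite ?F0 ?mul0r.
  rewrite cc0l ?cc0r ?mulr0 ?addr0 // => w wu; apply: F0.
    by rewrite /= eqxx.
  exact: subseq_trans wu (subseq_cons _ _).
- case: u => [|x u] G0 /=; first by case: b; rewrite ?G0 ?mulr0.
  by rewrite cc0r ?cc0l ?mulr0 ?addr0 // => w wu; apply: G0; rewrite /= eqxx.
Qed.

Lemma cc_scale b F G (a c : R) u :
  cc b (fun w => a * F w) (fun w => c * G w) u = a * c * cc b F G u.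
Proof.
elim: u b F G a c => [|x u IH] b F G a c /=; first by case: b => /=; ring2.
rewrite [cc b _ (sh x _) u](IH b F (sh x G) a c).
by rewrite [cc (~~ b) _ (sh x _) u](IH _ (sh x G) (sh x F) c a); ring2.
Qed.

(* Steenrod's coboundary formula for the cup-i products. *)
Lemma ld_cc b F G u :
  ld (cc b F G) u + cc b (ld F) G u + cc b F (ld G) u =
  wt b * (cc (~~ b) F G u + cc (~~ b) G F u).
Proof.
elim: u b F G => [|x u IH] b F G /=; first by case: b => /=; ring2.
have -> : ld (sh x (cc b F G)) u =
    ld (cc b F (sh x G)) u + wt b * ld (cc (~~ b) (sh x G) (sh x F)) u.
  rewrite -ldZ.
  exact: (ldD (cc b F (sh x G)) (fun w => wt b * cc (~~ b) (sh x G) (sh x F) w)).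
have -> : cc (~~ b) (sh x G) (sh x (ld F)) u =
    cc (~~ b) (sh x G) F u + cc (~~ b) (sh x G) (ld (sh x F)) u.
  exact: (ccDr (~~ b) (sh x G) F (ld (sh x F))).
have -> : cc b F (sh x (ld G)) u = cc b F G u + cc b F (ld (sh x G)) u.
  exact: (ccDr b F G (ld (sh x G))).
have -> : cc (~~ b) (sh x (ld G)) (sh x F) u =
    cc (~~ b) G (sh x F) u + cc (~~ b) (ld (sh x G)) (sh x F) u.
  exact: (ccDl (~~ b) G (ld (sh x G)) (sh x F)).
rewrite negbK.
have h1 := IH b F (sh x G); have h2 := IH (~~ b) (sh x G) (sh x F).
rewrite negbK in h2.
have e1 : forall a c d e : R, a + c + d = e -> a = e + c + d.
  by move=> a c d e <-; ring2.
rewrite (e1 _ _ _ _ h1) (e1 _ _ _ _ h2); case: (b) => /=; rewrite /wt; ring2.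
Qed.

(** * Joins with a block of consecutive vertices *)

Section Block.
Variables (pA pS : pred T) (v : T).
Hypothesis AS : forall x, pA x -> ~~ pS x.
Let fS := filter pS.
Let fN := filter (predC pS).

(* Lists have the form [a ++ t ++ n], where [t] consists of the vertices in the
   block [pS], and [a] of the vertices in [pA], which precede the block. *)
Definition tns P Q : seq T -> R := fun u => P (fS u) * Q (fN u).

Lemma ld_tns P Q u :
  ld (tns P Q) u = ld P (fS u) * Q (fN u) + P (fS u) * ld Q (fN u).
Proof.
elim: u P Q => [|x u IH] P Q /=; first by ring2.
case pSx: (pS x) => /=.
  have -> : ld (sh x (tns P Q)) u = ld (tns (sh x P) Q) u.
    by apply: ld_ext => w _; rewrite /sh /tns /= pSx.
  by rewrite IH /tns -[P (x :: _)]/(sh x P _); ring2.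
have -> : ld (sh x (tns P Q)) u = ld (tns P (sh x Q)) u.
  by apply: ld_ext => w _; rewrite /sh /tns /= pSx.
by rewrite IH /tns -[Q (x :: _)]/(sh x Q _); ring2.
Qed.

Lemma fS_cat t n : all pS t -> all (predC pS) n -> fS (t ++ n) = t.
Proof.
by move=> /all_filterP tS nN; rewrite /fS filter_cat tS filter_none ?cats0.
Qed.

Lemma fN_cat t n : all pS t -> all (predC pS) n -> fN (t ++ n) = n.
Proof.
by move=> tS /all_filterP nN; rewrite /fN filter_cat nN filterC_none.
Qed.

(** Each vertex of [t] shared by both factors interchanges the two cochains on the rest of the list.
    So [Q] and [Q'] are reversed exactly when the exponent coming from [t] is odd, and two odd
    exponents produce a factor [y]. *)
Lemma cc_tns b P P' Q Q' t n : all pS t -> all (predC pS) n ->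
  cc b (tns P Q) (tns P' Q') (t ++ n) =
  cc false P P' t * cc b Q Q' n + wt b * cc true P P' t * cc (~~ b) Q' Q n.
Proof.
elim: t b P P' Q Q' => [|x t IH] b P P' Q Q' /=.
  move=> _ nN; rewrite mulr0 mul0r addr0 -cc_scale.
  apply: cc_ext => w /mem_subseq wn; rewrite /tns.
    have wN : all (predC pS) w by apply/allP => z /wn; apply: (allP nN).
    by have := fS_cat (isT : all pS [::]) wN; have := fN_cat (isT : all pS [::]) wN
       => /= -> ->.
  have wN : all (predC pS) w by apply/allP => z /wn; apply: (allP nN).
  by have := fS_cat (isT : all pS [::]) wN; have := fN_cat (isT : all pS [::]) wN
     => /= -> ->.
case/andP=> xS tS nN.
have e P1 Q1 w : sh x (tns P1 Q1) w = tns (sh x P1) Q1 w.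
  by rewrite /sh /tns /= xS.
have -> : cc b (tns P Q) (sh x (tns P' Q')) (t ++ n) =
    cc b (tns P Q) (tns (sh x P') Q') (t ++ n) by apply: cc_ext.
have -> : cc (~~ b) (sh x (tns P' Q')) (sh x (tns P Q)) (t ++ n) =
    cc (~~ b) (tns (sh x P') Q') (tns (sh x P) Q) (t ++ n) by apply: cc_ext.
by rewrite !IH // negbK; case: b; rewrite /wt /=; ring2.
Qed.

Definition ins (w : seq T) : seq T := filter pA w ++ v :: filter (predC pA) w.

Lemma ins_cat a n : all pA a -> all (predC pA) n -> ins (a ++ n) = a ++ v :: n.
Proof.
move=> aA nA; rewrite /ins !filter_cat (all_filterP aA) (all_filterP nA).
by rewrite (filter_none nA) (filterC_none aA) cats0.
Qed.

(** Deleting a vertex other than [v] commutes with [ins]; deleting [v] gives [g (a ++ n)], which the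
    first summand on the right cancels. *)
Lemma ld_ins (M : nmodType) (g : seq T -> M) a n :
    (forall m : M, m + m = 0) -> all pA a -> all (predC pA) n ->
  ld (fun w => g (ins w)) (a ++ n) = g (a ++ n) + ld g (a ++ v :: n).
Proof.
move=> M2; elim: a g => [|x a IH] g /=.
  move=> _ nN; rewrite addrA M2 add0r; apply: ld_ext => w /mem_subseq wn.
  have wN : all (predC pA) w by apply/allP => z /wn; apply: (allP nN).
  by rewrite /ins (all_filterP wN) filter_none.
case/andP=> xA aA nN.
have -> : ld (sh x (fun w => g (ins w))) (a ++ n) =
    ld (fun w => sh x g (ins w)) (a ++ n).
  by apply: ld_ext => w _; rewrite /sh /ins /= xA.
by rewrite IH // ins_cat // addrCA.
Qed.

(* The cochain on the complex obtained by replacing the vertex [v] by the block: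
   [F(t) g(a n)] on the faces avoiding [v], corrected by [dF(t) g(a v n)]. *)
Definition Phi F g : seq T -> R :=
  fun u => tns F g u + tns (ld F) (fun w => g (ins w)) u.

Lemma fS_cat3 a t n :
  all pA a -> all pS t -> all (predC pS) n -> fS (a ++ t ++ n) = t.
Proof.
move=> aA tS nN; rewrite /fS filter_cat filter_none; first exact: fS_cat.
exact: sub_all aA.
Qed.

Lemma fN_cat3 a t n :
  all pA a -> all pS t -> all (predC pS) n -> fN (a ++ t ++ n) = a ++ n.
Proof.
move=> aA tS nN; rewrite /fN filter_cat -/(fN (t ++ n)) fN_cat //.
by have /all_filterP-> : all (predC pS) a by apply: sub_all aA.
Qed.

Lemma PhiE F g a t n :
  all pA a -> all pS t -> all (predC pS) n -> all (predC pA) n ->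
  Phi F g (a ++ t ++ n) = F t * g (a ++ n) + ld F t * g (a ++ v :: n).
Proof.
by move=> aA tS nN nA; rewrite /Phi /tns fS_cat3 // fN_cat3 // ins_cat.
Qed.

(** By [ld_tns] the first term of [Phi] contributes dF(t) g(a n), and by [ld_ins] the second
    contributes the same expression. Their cancellation is the reason for the correction term. *)
Lemma ld_Phi F g a t n :
  all pA a -> all pS t -> all (predC pS) n -> all (predC pA) n ->
  ld (Phi F g) (a ++ t ++ n) = Phi F (ld g) (a ++ t ++ n).
Proof.
move=> aA tS nN nA.
rewrite PhiE // /Phi ldD !ld_tns (ldK _ _ addrr2) mul0r add0r.
by rewrite fS_cat3 // fN_cat3 // (ld_ins _ addrr2) //; ring2.
Qed.

(** * The homotopy behind the Cartan formula *)

Section Homotopy.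
Variable F : seq T -> R.
Notation dF := (ld F).
Implicit Types g h : seq T -> R.

(* [target] is the generating function of [Phi (F \cup_j F) (g \cup_k h)]. The
   homotopy from the products of [Phi F g] and [Phi F h] to it is found by hand
   for [a = [::]] and is extended over [a] by the recursion defining [cc]. The
   last summand of [hbase] undoes the interchange of [g] and [h] that an odd
   exponent in the block causes. *)
Definition hbase b g h : seq T -> R := fun u =>
  wt b * tns (cc true F dF) (cc (~~ b) (sh v h) (sh v g)) u +
  tns (cc false dF F) (cc b (sh v g) (sh v h)) u +
  (if b then tns (cc true F F) (cc true g h) u +
    tns (fun t => cc true F dF t + cc true dF F t)
        (fun n => cc true g h (v :: n)) u else 0).

Fixpoint htpy b g h (u : seq T) : R :=
  if u is x :: u' then
    if pA x then htpy b g (sh x h) u' + wt b * htpy (~~ b) (sh x h) (sh x g) u'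
    else hbase b g h u
  else hbase b g h [::].

Definition target b g h a t n : R :=
  cc false F F t * cc b g h (a ++ n) +
  wt b * (cc true F F t * cc (~~ b) g h (a ++ n)) +
  (cc false F dF t + cc false dF F t) * cc b g h (a ++ v :: n) +
  wt b * ((cc true F dF t + cc true dF F t) * cc (~~ b) g h (a ++ v :: n)).

Lemma htpyE b g h u : all (predC pA) u -> htpy b g h u = hbase b g h u.
Proof. by case: u => //= x u /andP[/negPf-> _]. Qed.

Lemma ld_hbase b g h t n : all pS t -> all (predC pS) n ->
  ld (hbase b g h) (t ++ n) =
  wt b * (ld (cc true F dF) t * cc (~~ b) (sh v h) (sh v g) n +
          cc true F dF t * ld (cc (~~ b) (sh v h) (sh v g)) n) +
  (ld (cc false dF F) t * cc b (sh v g) (sh v h) n +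
   cc false dF F t * ld (cc b (sh v g) (sh v h)) n) +
  (if b then ld (cc true F F) t * cc true g h n +
     cc true F F t * ld (cc true g h) n +
     ((ld (cc true F dF) t + ld (cc true dF F) t) * cc true g h (v :: n) +
      (cc true F dF t + cc true dF F t) * ld (sh v (cc true g h)) n) else 0).
Proof.
move=> tS nN; rewrite /hbase.
case: b; last first.
  rewrite (ld_ext (Y := fun w =>
    wt false * tns (cc true F dF) (cc (~~ false) (sh v h) (sh v g)) w +
    tns (cc false dF F) (cc false (sh v g) (sh v h)) w)); last first.
    by move=> w _; rewrite addr0.
  by rewrite ldD ldZ !ld_tns fS_cat // fN_cat // addr0.
do 3 rewrite ldD; rewrite ldZ !ld_tns fS_cat // fN_cat //.
by congr (_ + (_ + (_ * _ + _))); apply: ldD.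
Qed.

(** With [a] empty, [cc_tns] expands everything into products of a factor on [t] and a factor on
    [n]. Steenrod's formula [ld_cc], used on both kinds of factors, leaves a polynomial identity in
    characteristic 2. *)
Lemma homotopy_base b g h t n :
  all pS t -> all (predC pS) n -> all (predC pA) n ->
  cc b (Phi F g) (Phi F h) (t ++ n) + target b g h [::] t n =
  ld (htpy b g h) (t ++ n) + htpy b (ld g) h (t ++ n) + htpy b g (ld h) (t ++ n) +
  wt b * (htpy (~~ b) g h (t ++ n) + htpy (~~ b) h g (t ++ n)).
Proof.
move=> tS nN nA.
have tA : all (predC pA) t.
  by apply: sub_all tS => x xS /=; apply: contraL xS; apply: AS.
have tnA : all (predC pA) (t ++ n) by rewrite all_cat tA nA.
have sub w : subseq w (t ++ n) -> all (predC pA) w.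
  by move=> /mem_subseq wu; apply/allP => z /wu; apply: (allP tnA).
have PhiE0 g0 w : subseq w (t ++ n) ->
    Phi F g0 w = tns F g0 w + tns dF (sh v g0) w.
  move=> /sub wA; rewrite /Phi; congr (_ + _); rewrite /tns /ins.
  have nwA : all (predC pA) (fN w).
    by apply/allP => z; rewrite mem_filter => /andP[_ zw]; apply: (allP wA).
  by rewrite filter_none // (all_filterP nwA).
rewrite (cc_ext _ (PhiE0 g) (PhiE0 h)) ccDl !ccDr !cc_tns //.
rewrite (ld_ext (Y := hbase b g h)); last by move=> w /sub; apply: htpyE.
rewrite !htpyE // ld_hbase // /hbase /tns fS_cat // fN_cat //.
have shd g0 w : sh v (ld g0) w = g0 w + ld (sh v g0) w by [].
have eqD (a c d e : R) : a + c + d = e -> a = e + c + d by move=> <-; ring2.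
have lF b0 := eqD _ _ _ _ (ld_cc b0 F F t).
have lFd b0 := eqD _ _ _ _ (ld_cc b0 F dF t).
have ldF b0 := eqD _ _ _ _ (ld_cc b0 dF F t).
have ddF w : ld dF w = 0 by apply: ldK addrr2.
have dd0l b0 G : cc b0 (ld dF) G t = 0 by apply: cc0l.
have dd0r b0 G : cc b0 G (ld dF) t = 0 by apply: cc0r.
have lgh b0 X Y := eqD _ _ _ _ (ld_cc b0 X Y n).
have lghv X Y : ld (sh v (cc true X Y)) n =
    ld (cc true X (sh v Y)) n + ld (cc false (sh v Y) (sh v X)) n.
  rewrite -ldD; apply: ld_ext => w _; by rewrite /sh /= mul1r.
rewrite lghv lF lFd ldF !dd0l !dd0r !lgh.
have shl b0 g0 Y : cc b0 (sh v (ld g0)) Y n = cc b0 g0 Y n + cc b0 (ld (sh v g0)) Y n.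
  exact: (ccDl b0 g0 (ld (sh v g0))).
have shr b0 g0 Y : cc b0 Y (sh v (ld g0)) n = cc b0 Y g0 n + cc b0 Y (ld (sh v g0)) n.
  exact: (ccDr b0 Y g0 (ld (sh v g0))).
rewrite !shl !shr /target.
case: (b) => /=; rewrite ?lghv ?lF ?lFd ?ldF ?dd0l ?dd0r ?lgh ?shl ?shr /wt /=; ring2.

Qed.

Lemma htpyDl b g g' h u :
  htpy b (fun w => g w + g' w) h u = htpy b g h u + htpy b g' h u
with htpyDr b g h h' u :
  htpy b g (fun w => h w + h' w) u = htpy b g h u + htpy b g h' u.
Proof.
- have base : hbase b (fun w => g w + g' w) h u = hbase b g h u + hbase b g' h u.
    rewrite /hbase /tns [cc (~~ b) _ (sh v _) _](ccDr _ _ (sh v g) (sh v g')).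
    rewrite [cc b (sh v _) _ _](ccDl _ (sh v g) (sh v g')) !(ccDl true g g').
    by case: b; rewrite /wt /=; ring2.
  case: u base => [|x u] //= base; case: (pA x) => //.
  rewrite htpyDl [htpy (~~ b) _ (sh x _) _](htpyDr _ (sh x h) (sh x g) (sh x g')).
  by ring2.
- have base : hbase b g (fun w => h w + h' w) u = hbase b g h u + hbase b g h' u.
    rewrite /hbase /tns [cc (~~ b) (sh v _) _ _](ccDl _ (sh v h) (sh v h')).
    rewrite [cc b _ (sh v _) _](ccDr _ _ (sh v h) (sh v h')) !(ccDr true g h h').
    by case: b; rewrite /wt /=; ring2.
  case: u base => [|x u] //= base; case: (pA x) => //.
  rewrite [htpy b _ (sh x _) _](htpyDr _ g (sh x h) (sh x h')).
  by rewrite [htpy (~~ b) (sh x _) _ _](htpyDl _ (sh x h) (sh x h')); ring2.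
Qed.

(** Since [htpy] follows the recursion of [cc] along [a], the claim is a combination of two
    instances of the induction hypothesis and of the terms in which [ld] deletes the first
    vertex. *)
Lemma homotopy b g h a t n :
  all pA a -> all pS t -> all (predC pS) n -> all (predC pA) n ->
  let u := a ++ t ++ n in
  cc b (Phi F g) (Phi F h) u + target b g h a t n =
  ld (htpy b g h) u + htpy b (ld g) h u + htpy b g (ld h) u +
  wt b * (htpy (~~ b) g h u + htpy (~~ b) h g u).
Proof.
move=> aA tS nN nA; elim: a aA b g h => [_|x a IH /= /andP[xA aA]] b g h.
  exact: (homotopy_base b g h tS nN nA).
set u := a ++ t ++ n; have {IH} IH b0 g0 h0 := IH aA b0 g0 h0.
have PhiS g0 w : sh x (Phi F g0) w = Phi F (sh x g0) w.
  by rewrite /sh /Phi /tns /ins /= (negPf (AS xA)) /= xA.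
have hS b0 g0 h0 w : sh x (htpy b0 g0 h0) w =
    htpy b0 g0 (sh x h0) w + wt b0 * htpy (~~ b0) (sh x h0) (sh x g0) w.
  by rewrite /sh /= xA.
rewrite xA (ld_ext (fun w _ => hS b g h w)) ldD ldZ.
rewrite (cc_ext b (fun _ _ => erefl) (fun w _ => PhiS h w)).
rewrite (cc_ext (~~ b) (fun w _ => PhiS h w) (fun w _ => PhiS g w)).
have h1 := IH b g (sh x h); have h2 := IH (~~ b) (sh x h) (sh x g).
rewrite -/u in h1 h2 *.
have shd g0 : sh x (ld g0) = fun w => g0 w + ld (sh x g0) w by [].
rewrite !shd !htpyDl !htpyDr !negbK in h1 h2 *.
have eqD (c d e : R) : c + d = e -> c = e + d by move=> <-; ring2.
rewrite (eqD _ _ _ h1) (eqD _ _ _ h2) /target /= negbK.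
by case: (b); rewrite /wt /=; ring2.
Qed.

(** Applied to a coboundary in place of [g], this removes the terms of [homotopy] that contain
    [ld g] or [ld h]. The disjunction mirrors the two kinds of faces of the new complex. *)
Lemma htpy0 b g h a t n :
    all pA a -> all pS t -> all (predC pS) n -> all (predC pA) n ->
    (forall w, subseq w (a ++ n) -> g w = 0) ->
    (forall w, subseq w t -> dF w = 0) \/
    (forall w, subseq w (a ++ v :: n) -> g w = 0) ->
  htpy b g h (a ++ t ++ n) = 0 /\ htpy b h g (a ++ t ++ n) = 0.
Proof.
move=> aA tS nN nA; elim: a aA b g h => [_|x a IH /= /andP[xA aA]] b g h g0 vg.
  have tA : all (predC pA) t.
    by apply: sub_all tS => x xS /=; apply: contraL xS; apply: AS.
  have tnA : all (predC pA) (t ++ n) by rewrite all_cat tA nA.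
  rewrite cat0s !htpyE // /hbase /tns fS_cat // fN_cat //=.
  case: vg => [dF0|vg].
    have l0 b0 : cc b0 F dF t = 0 by apply: cc0r.
    have r0 b0 : cc b0 dF F t = 0 by apply: cc0l.
    rewrite !l0 !r0; case: b => /=; last by split; ring2.
    by rewrite (cc0l _ _ g0) (cc0r _ _ g0); split; ring2.
  have g1 w : subseq w n -> sh v g w = 0.
    by move=> wn; apply: vg; rewrite /= eqxx.
  have l0 b0 Y : cc b0 (sh v g) Y n = 0 by apply: cc0l.
  have r0 b0 Y : cc b0 Y (sh v g) n = 0 by apply: cc0r.
  have gl b0 Y : cc b0 g Y n = 0 by apply: cc0l.
  have gr b0 Y : cc b0 Y g n = 0 by apply: cc0r.
  by case: b; rewrite /= !l0 !r0 ?gl ?gr; split; ring2.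
have sg w : subseq w (a ++ n) -> sh x g w = 0.
  by move=> wn; apply: g0; rewrite /= eqxx.
have gs w : subseq w (a ++ n) -> g w = 0.
  by move=> wn; apply: g0; apply: subseq_trans wn (subseq_cons _ _).
have [sv gv] : ((forall w, subseq w t -> dF w = 0) \/
     (forall w, subseq w (a ++ v :: n) -> sh x g w = 0)) /\
   ((forall w, subseq w t -> dF w = 0) \/
     (forall w, subseq w (a ++ v :: n) -> g w = 0)).
  case: vg => [dF0|vg]; first by split; left.
  split; right => w wn; apply: vg; first by rewrite /= eqxx.
  exact: subseq_trans wn (subseq_cons _ _).
rewrite xA; have [-> _] := IH aA b g (sh x h) gs gv.
have [_ ->] := IH aA b (sh x g) h sg sv.
have [-> ->] := IH aA (~~ b) (sh x g) (sh x h) sg sv.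
by split; ring2.
Qed.
End Homotopy.

End Block.
End Ring.
End Lists.

(* Not earlier, since this redefines the tactic [ring] used in [ring2]. *)
From mathcomp Require Import zify ring.

(** * Cup-i products over F_2 *)

Section Cup.
Variable T : eqType.
Implicit Types (f g h : seq T -> 'F_2) (F G : seq T -> {poly 'F_2}).

Fact F2_two : 2%:R = 0 :> 'F_2. Proof. exact: pchar_Zp. Qed.
Fact polyF2_two : 2%:R = 0 :> {poly 'F_2}.
Proof. by rewrite -polyC_natr F2_two. Qed.

Definition cp F G u : {poly 'F_2} :=
  cc ('X * 'X) false F G u + 'X * cc ('X * 'X) true F G u.

Definition lift f : seq T -> {poly 'F_2} := fun u => (f u)%:P.

(* The index is shifted by one: [cupn i.+1] is the cup-i product. *)
Definition cupn n f g u : 'F_2 := (cp (lift f) (lift g) u)`_n.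

Lemma cp_cons F G x u :
  cp F G (x :: u) = cp F (sh x G) u + 'X * cp (sh x G) (sh x F) u.
Proof.
by rewrite /cp /= /wt /=; ring.
Qed.

Lemma cupn_nil n f g : cupn n f g [::] = if n == 0%N then f [::] * g [::] else 0.
Proof. by rewrite /cupn /cp /= mulr0 addr0 /lift -polyCM coefC. Qed.

Lemma cupn_cons n f g x u : cupn n f g (x :: u) =
  cupn n f (sh x g) u + if n is n'.+1 then cupn n' (sh x g) (sh x f) u else 0.
Proof. by rewrite /cupn cp_cons coefD coefXM; case: n. Qed.

Lemma cp_ext F F' G G' u :
    (forall w, subseq w u -> F w = F' w) ->
    (forall w, subseq w u -> G w = G' w) ->
  cp F G u = cp F' G' u.
Proof. by move=> eF eG; rewrite /cp !(cc_ext _ _ eF eG). Qed.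

Lemma cpDl F F' G u : cp (fun w => F w + F' w) G u = cp F G u + cp F' G u.
Proof. by rewrite /cp !(ccDl _ polyF2_two); ring. Qed.

Lemma cpDr F G G' u : cp F (fun w => G w + G' w) u = cp F G u + cp F G' u.
Proof. by rewrite /cp !(ccDr _ polyF2_two); ring. Qed.

Lemma cupn_ext n f f' g g' u :
    (forall w, subseq w u -> f w = f' w) ->
    (forall w, subseq w u -> g w = g' w) ->
  cupn n f g u = cupn n f' g' u.
Proof.
by move=> ef eg; congr (polyseq _)`_n; apply: cp_ext => w wu; rewrite /lift ?ef ?eg.
Qed.

Lemma cupn0l n f g u : (forall w, subseq w u -> f w = 0) -> cupn n f g u = 0.
Proof.
move=> f0; rewrite /cupn /cp !(cc0l, mulr0, addr0, coef0) //.
all: by move=> w /f0; rewrite /lift => ->; rewrite polyC0.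
Qed.

Lemma cupn0r n f g u : (forall w, subseq w u -> g w = 0) -> cupn n f g u = 0.
Proof.
move=> f0; rewrite /cupn /cp !(cc0r, mulr0, addr0, coef0) //.
all: by move=> w /f0; rewrite /lift => ->; rewrite polyC0.
Qed.

Lemma cupnDl n f f' g u :
  cupn n (fun w => f w + f' w) g u = cupn n f g u + cupn n f' g u.
Proof.
rewrite -coefD -cpDl; congr (polyseq _)`_n.
by apply: cp_ext => // w _; rewrite /lift polyCD.
Qed.

Lemma cupnDr n f g g' u :
  cupn n f (fun w => g w + g' w) u = cupn n f g u + cupn n f g' u.
Proof.
rewrite -coefD -cpDr; congr (polyseq _)`_n.
by apply: cp_ext => // w _; rewrite /lift polyCD.
Qed.

Lemma ld_lift f u : ld (lift f) u = lift (ld f) u.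
Proof. exact: (ld_additive (@polyC 'F_2)). Qed.

Lemma ld_cp F G u : ld (cp F G) u + cp (ld F) G u + cp F (ld G) u =
  'X * (cp F G u + cp G F u).
Proof.
rewrite /cp ldD ldZ.
transitivity (('X * 'X) * (cc ('X * 'X) true F G u + cc ('X * 'X) true G F u) +
  'X * (cc ('X * 'X) false F G u + cc ('X * 'X) false G F u)); last first.
  by ring.
have e b := ld_cc ('X * 'X) polyF2_two b F G u.
have := e true; have := e false; rewrite /wt /= mul1r => <- <-.
by ring.
Qed.

Lemma ld_cupn n f g u :
  ld (cupn n f g) u + cupn n (ld f) g u + cupn n f (ld g) u =
  if n is n'.+1 then cupn n' f g u + cupn n' g f u else 0.
Proof.
have -> : ld (cupn n f g) u = (ld (cp (lift f) (lift g)) u)`_n.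
  exact: (ld_additive (coefp n)).
have e1 : cupn n (ld f) g u = (cp (ld (lift f)) (lift g) u)`_n.
  by congr (polyseq _)`_n; apply: cp_ext => // w _; rewrite ld_lift.
have e2 : cupn n f (ld g) u = (cp (lift f) (ld (lift g)) u)`_n.
  by congr (polyseq _)`_n; apply: cp_ext => // w _; rewrite ld_lift.
by rewrite e1 e2 -!coefD ld_cp coefXM; case: n {e1 e2} => //= n; rewrite coefD.
Qed.

(** The two subfaces on which [f] and [g] are evaluated cover [u] and have exactly [n] vertices in
    common. *)
Lemma cupn_size P Q n f g u :
    (forall w, size w != P -> f w = 0) -> (forall w, size w != Q -> g w = 0) ->
  (P + Q != size u + n)%N -> cupn n f g u = 0.
Proof.
elim: u P Q n f g => [|x u IH] P Q n f g fP gQ /= PQ.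
  rewrite cupn_nil; case: eqP => // n0.
  case: (eqVneq P 0%N) => [P0|P0]; last by rewrite fP ?mul0r // eq_sym.
  by rewrite gQ ?mulr0 //= eq_sym; lia.
have sP w : (size w != P.-1) || (P == 0%N) -> sh x f w = 0.
  by move=> wP; apply: fP => /=; lia.
have sQ w : (size w != Q.-1) || (Q == 0%N) -> sh x g w = 0.
  by move=> wQ; apply: gQ => /=; lia.
rewrite cupn_cons; case: (posnP Q) => Q0.
  have g0 w : subseq w u -> sh x g w = 0 by move=> _; apply: sQ; lia.
  by rewrite cupn0r //; case: n PQ => [|n] PQ; rewrite ?cupn0l ?addr0.
rewrite (IH P Q.-1) //; try lia; last by move=> w wQ; apply: sQ; lia.
case: n PQ => [|n] PQ; rewrite add0r //.
case: (posnP P) => P0; first by rewrite cupn0r // => w _; apply: sP; lia.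
by rewrite (IH Q.-1 P.-1) //; [move=> w wQ; apply: sQ|move=> w wP; apply: sP|]; lia.
Qed.

Lemma cupn_gt n f g u : (size u < n)%N -> cupn n f g u = 0.
Proof.
elim: u n f g => [|x u IH] [|n] f g //= un; first by rewrite cupn_nil.
by rewrite cupn_cons !IH ?addr0 //; lia.
Qed.

Lemma cupn_top f g u : cupn (size u) f g u = f u * g u.
Proof.
elim: u f g => [|x u IH] f g; first by rewrite cupn_nil.
by rewrite cupn_cons /= cupn_gt // add0r IH mulrC.
Qed.

Lemma cupn0 f g u : cupn 0 f g u = f [::] * g u.
Proof.
elim: u f g => [|x u IH] f g; first by rewrite cupn_nil.
by rewrite cupn_cons IH addr0.
Qed.

(** This makes Sq^0 the identity: both subfaces are [u] itself, and squaring is the identity on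
    F_2. *)
Lemma cupn_diag P f u : (forall w, size w != P -> f w = 0) -> cupn P f f u = f u.
Proof.
move=> fP; case: (eqVneq (size u) P) => [<-|uP].
  rewrite cupn_top; case: (f u) => -[|[|//]] i; exact: val_inj.
by rewrite (fP u) // (cupn_size fP fP) // eqn_add2r eq_sym.
Qed.

(** An overlap of [n] vertices does not fit into a subface with [P] vertices. *)
Lemma cupn_high P n f u :
  (forall w, size w != P -> f w = 0) -> (P < n)%N -> cupn n f f u = 0.
Proof.
move=> fP Pn; case: (eqVneq (P + P)%N (size u + n)%N) => [uP|]; last first.
  exact: (cupn_size fP fP).
by apply: cupn0l => w /size_subseq wu; apply: fP; lia.
Qed.

Section Block.
Variables (pA pS : pred T) (v : T).
Hypothesis AS : forall x, pA x -> ~~ pS x.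

Lemma cupn_Phi k f g : exists W : seq T -> 'F_2, forall a t n,
    all pA a -> all pS t -> all (predC pS) n -> all (predC pA) n ->
    (forall w, subseq w (a ++ n) -> ld g w = 0) ->
    (forall w, subseq w t -> ld f w = 0) \/
    (forall w, subseq w (a ++ v :: n) -> ld g w = 0) ->
  cupn k (Phi pA pS v f g) (Phi pA pS v f g) (a ++ t ++ n) =
  \sum_(j < k.+1) Phi pA pS v (cupn j f f) (cupn (k - j) g g) (a ++ t ++ n) +
  ld W (a ++ t ++ n).
Proof.
pose F := lift f; pose G := lift g; pose y : {poly 'F_2} := 'X * 'X.
pose H u := htpy y pA pS v F false G G u + 'X * htpy y pA pS v F true G G u.
exists (fun u => (H u)`_k) => a t n aA tS nN nA g0 vg.
set u := a ++ t ++ n.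
have G0 w : subseq w (a ++ n) -> ld G w = 0.
  by move=> /g0 e; rewrite ld_lift /lift e polyC0.
have VG : (forall w, subseq w t -> ld F w = 0) \/
    (forall w, subseq w (a ++ v :: n) -> ld G w = 0).
  by case: vg => e; [left|right] => w /e e'; rewrite ld_lift /lift e' polyC0.
have hm b := homotopy y polyF2_two v AS F b G G aA tS nN nA.
have h0 b := htpy0 y polyF2_two AS b G aA tS nN nA G0 VG.
(* With both arguments equal to [G], the terms that interchange them cancel in pairs, and [htpy0]
   removes those with [ld G]. *)
have {}hm b : cc y b (Phi pA pS v F G) (Phi pA pS v F G) u =
    target y v F b G G a t n + ld (htpy y pA pS v F b G G) u.
  have [l0 r0] := h0 b; have {hm} := hm b.
  rewrite -/u in l0 r0 *; rewrite /= l0 r0 !addr0 (addrr2 polyF2_two) mulr0 addr0.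
  by move=> e; rewrite -e addrC -addrA (addrr2 polyF2_two) addr0.
rewrite /cupn.
have -> : cp (lift (Phi pA pS v f g)) (lift (Phi pA pS v f g)) u =
    cp (Phi pA pS v F G) (Phi pA pS v F G) u.
  by apply: cp_ext => w _; rewrite /lift /Phi /tns -!/(lift _ _) polyCD !polyCM ld_lift.
rewrite {1}/cp !hm mulrDr addrACA -ldZ -ldD -/H coefD.
congr (_ + _); last exact/esym/(ld_additive (coefp k)).
pose p := cp F F; pose q := cp G G.
(* For equal arguments the two values of [target] are the even and the odd part of a sum of products
   of polynomials; recombining them makes the convolution of coefficients visible. *)
have -> : target y v F false G G a t n + 'X * target y v F true G G a t n =
    p t * q (a ++ n) + ld p t * q (a ++ v :: n).
  have -> : ld p t = cp (ld F) F t + cp F (ld F) t.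
    have := ld_cp F F t; rewrite (addrr2 polyF2_two) mulr0 => e.
    by rewrite -[RHS]add0r -e -[_ + _ + _]addrA -addrA (addrr2 polyF2_two) addr0.
  rewrite /target /p /q /cp -/y /wt /=.
  by rewrite /y; ring.
rewrite coefD !coefM.
rewrite [RHS](eq_bigr (fun j : 'I_k.+1 => cupn j f f t * cupn (k - j) g g (a ++ n) +
    ld (cupn j f f) t * cupn (k - j) g g (a ++ v :: n))); last first.
  by move=> j _; rewrite /u (PhiE v AS).
rewrite big_split /=; congr (_ + _); apply: eq_bigr => j _ //.
by congr (_ * _); rewrite -[LHS]/(coefp j _) -ld_additive.
Qed.
End Block.
End Cup.

(** * Cochains on list functions *)

Section CupSum.
Variable T : finType.
Implicit Types (X Y : seq T -> 'F_2) (u : seq T) (U : {set T}).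

Lemma ld_sum X u : uniq u -> ld X u = \sum_(x <- u) X (filter (predC1 x) u).
Proof.
elim: u X => [|x u IH] X /=; first by rewrite big_nil.
case/andP=> xu uu; rewrite big_cons eqxx /= IH //; congr (_ + _).
  by congr X; apply/esym/all_filterP/allP => z zu /=; apply: contraNneq xu => <-.
rewrite !big_seq; apply: eq_bigr => z zu /=.
by rewrite /sh; case: eqVneq zu xu => //= -> ->.
Qed.

Let odd_pos U u z := odd (index z [seq x <- u | x \in U] + index z u).

(** The two terms of the recursion correspond to whether the first vertex lies in [U]. If it does,
    the positions of a later vertex in [U] and in [u] both move by one and parities stay. If not,
    only the position in [u] moves, so all parities flip, which is the interchange of [X] and
    [Y]. *)
Lemma cupn_sum n X Y u : uniq u -> cupn n X Y u =
  \sum_(U : {set T} | (U \subset [set x in u]) && (#|U| + n == size u)%N)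
    X [seq z <- u | ~~ ((z \in U) && ~~ odd_pos U u z)] *
    Y [seq z <- u | ~~ ((z \in U) && odd_pos U u z)].
Proof.
elim: u n X Y => [|x u IH] n X Y /= => [_|/andP[xu uu]].
  rewrite cupn_nil; case: ifP => [/eqP-> | n0]; last first.
    rewrite big1 // => U /andP[]; rewrite addn_eq0 n0 andbF //.
  rewrite (big_pred1 set0) // => U /=; rewrite addn0 cards_eq0.
  by apply/andP/eqP => [[_ /eqP]|->]; rewrite ?eqxx ?sub0set.
have xNset : x \notin [set z in u] by rewrite inE.
rewrite cupn_cons (bigID (fun U => x \in U)) /=; congr (_ + _).
  rewrite IH // [RHS](reindex_onto (fun U => x |: U) (fun U => U :\ x)) /=;
    last by move=> U /andP[_ xU]; rewrite setD1K.
  apply: eq_big => [U | U /andP[Uu _]].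
    rewrite setU11 andbT; case xU: (x \in U).
      apply/idP/idP => [/andP[/subsetP/(_ x xU) xu' _]|/andP[_ /eqP e]].
        by rewrite xu' in xNset.
      by move: xU; rewrite -e !inE eqxx.
    rewrite setU1K ?xU // eqxx andbT cardsU1 xU /= add1n addSn eqSS; congr (_ && _).
    rewrite subUset sub1set !inE eqxx /=; apply/subsetP/subsetP => sU z zU.
      by have := sU z zU; rewrite !inE => ->; rewrite orbT.
    have := sU z zU; rewrite !inE; case: eqP => //= zx; by rewrite -zx zU in xU.
  have xU : x \notin U by apply: contra xNset => /(subsetP Uu).
  have fU : [seq z <- u | z \in x |: U] = [seq z <- u | z \in U].
    apply: eq_in_filter => z zu; rewrite !inE; case: eqVneq => //= zx.
    by rewrite -zx zu in xu.
  have pU z : z \in u -> odd_pos (x |: U) (x :: u) z = odd_pos U u z.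
    move=> zu; rewrite /odd_pos /= setU11 /= fU eq_sym.
    case: eqVneq => [zx|_]; first by rewrite -zx zu in xu.
    by rewrite addSn addnS /= negbK.
  have px : odd_pos (x |: U) (x :: u) x = false.
    by rewrite /odd_pos /= setU11 /= eqxx.
  rewrite setU11 px /=; congr (X _ * Y (_ :: _)); apply: eq_in_filter => z zu;
    rewrite pU // in_setU1; case: eqVneq => [zx|//]; by rewrite -zx zu in xu.
have cond U : (U \subset [set z in x :: u]) && (x \notin U) = (U \subset [set z in u]).
  apply/andP/idP => [[/subsetP sU xU] | sU].
    apply/subsetP => z zU; have := sU z zU; rewrite !inE; case: eqP => //= zx.
    by rewrite -zx zU in xU.
  split; last by apply: contra xNset => /(subsetP sU).
  by apply/subsetP => z /(subsetP sU); rewrite !inE => ->; rewrite orbT.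
case: n => [|n].
  rewrite big_pred0 // => U; rewrite andbAC cond addn0; apply/negbTE.
  rewrite negb_and; case sU: (U \subset _) => //=; rewrite neq_ltn ltnS.
  by rewrite (leq_trans (subset_leq_card sU)) // cardsE card_size.
rewrite IH //; apply: eq_big => [U | U /andP[sU _]].
  by rewrite andbAC cond addnS eqSS.
have xU : x \notin U by apply: contra xNset => /(subsetP sU).
have pU z : z \in u -> odd_pos U (x :: u) z = ~~ odd_pos U u z.
  move=> zu; rewrite /odd_pos /= (negPf xU) eq_sym.
  case: eqVneq => [zx|_]; first by rewrite -zx zu in xu.
  by rewrite addnS.
rewrite (negPf xU) /= mulrC; congr (X (_ :: _) * Y (_ :: _));
  by apply: eq_in_filter => z zu; rewrite pU // negbK.
Qed.
End CupSum.

Lemma addrr_F2 (V : lmodType 'F_2) (x : V) : x + x = 0.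
Proof. by rewrite -mulr2n -scaler_nat F2_two scale0r. Qed.

Lemma oppr_F2 (V : lmodType 'F_2) (x : V) : - x = x.
Proof. by apply/eqP; rewrite eq_sym -addr_eq0 addrr_F2. Qed.

Lemma F2_addrr (a : 'F_2) : a + a = 0.
Proof. exact: addrr2 F2_two a. Qed.

Section Enum.
Variable T : finType.

Lemma enum_filter (A B : {set T}) (p : pred T) :
  (forall x, (x \in A) = (x \in B) && p x) -> enum A = filter p (enum B).
Proof.
move=> AB; rewrite /enum_mem -filter_predI; apply: eq_filter => x /=.
by rewrite AB andbC.
Qed.

Lemma enum_list (u : seq T) : subseq u (enum T) -> enum [set x in u] = u.
Proof.
move/(subseq_uniqP (enum_uniq T)) => ->; rewrite {1}/enum_mem enumT.
by apply: eq_filter => x /=; rewrite inE mem_filter -enumT mem_enum andbT.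
Qed.

Lemma enum_set_sub (A : {set T}) : subseq (enum A) (enum T).
Proof. by rewrite {1}/enum_mem enumT filter_subseq. Qed.
End Enum.

Section Cochains.
Variables (T : finType) (K : complex T).
Implicit Types (X Y Z : seq T -> 'F_2) (u w : seq T) (f g : cochain K).

Definition klist u := subseq u (enum T) && ([set x in u] \in faces K).

Definition mk X : cochain K := [ffun s : face K => X (enum (val s))].

Definition rd f : seq T -> 'F_2 := fun u => value f [set x in u].

Lemma klist_enum (s : {set T}) : s \in faces K -> klist (enum s).
Proof. by rewrite /klist enum_set_sub set_enum. Qed.

Lemma klist_sub w u : subseq w u -> klist u -> klist w.
Proof.
move=> wu /andP[uT uK]; rewrite /klist (subseq_trans wu uT).
apply: complexS uK; apply/subsetP => x; rewrite !inE; exact: mem_subseq wu x.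
Qed.

Lemma value_mk X (s : {set T}) : s \in faces K -> value (mk X) s = X (enum s).
Proof. by move=> sK; rewrite -[s]/(val (Sub s sK : face K)) value_face ffunE. Qed.

Lemma rd_mk X u : klist u -> rd (mk X) u = X u.
Proof. by case/andP=> uT uK; rewrite /rd value_mk // enum_list. Qed.

Lemma mk_rd f : mk (rd f) = f.
Proof. by apply/ffunP => s; rewrite ffunE /rd set_enum value_face. Qed.

Lemma mk_ext X Y : (forall u, klist u -> X u = Y u) -> mk X = mk Y.
Proof.
by move=> XY; apply/ffunP => s; rewrite !ffunE XY // klist_enum // (valP s).
Qed.

Lemma mk_inj X Y : mk X = mk Y -> forall u, klist u -> X u = Y u.
Proof. by move=> XY u uK; rewrite -(rd_mk X uK) XY rd_mk. Qed.

Lemma mkD X Y : mk (fun u => X u + Y u) = mk X + mk Y.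
Proof. by apply/ffunP => s; rewrite !ffunE. Qed.

Lemma mk_sum (I : Type) (r : seq I) (F : I -> seq T -> 'F_2) :
  \sum_(i <- r) mk (F i) = mk (fun u => \sum_(i <- r) F i u).
Proof.
apply/ffunP => s; rewrite sum_ffunE ffunE.
by apply: eq_bigr => i _; rewrite ffunE.
Qed.

Lemma mk0 : mk (fun=> 0) = 0.
Proof. by apply/ffunP => s; rewrite !ffunE. Qed.

Lemma cobound_mk X : cobound (mk X) = mk (ld X).
Proof.
apply/ffunP => s; rewrite !ffunE ld_sum ?enum_uniq // big_enum.
apply: eq_bigr => v vs; rewrite value_mk; last first.
  exact: complexS (subsetDl _ _) (valP s).
by congr X; apply: enum_filter => x; rewrite !inE andbC.
Qed.

Lemma cup_mk i X Y : cup i (mk X) (mk Y) = mk (cupn i.+1 X Y).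
Proof.
apply/ffunP => s; rewrite !ffunE cupn_sum ?enum_uniq //.
apply: eq_big => [U | U /andP[/subsetP Us _]].
  by rewrite set_enum -cardE.
have eU : enum U = [seq z <- enum (val s) | z \in U].
  by apply: enum_filter => x; case: (boolP (x \in U)) => [/Us->|]; rewrite ?andbF.
rewrite /= !value_mk; try exact: complexS (subsetDl _ _) (valP s).
congr (X _ * Y _); apply: enum_filter => x; rewrite /rank -eU !inE andbC;
  by [].
Qed.

Definition tr (P : nat) X : seq T -> 'F_2 :=
  fun u => if size u == P then X u else 0.

Lemma component_mk p X : component p (mk X) = mk (tr p.+1 X).
Proof. by apply/ffunP => s; rewrite !ffunE /tr -cardE. Qed.

Lemma cocycles_mk X :
  (mk X \in cocycles K) <-> (forall u, klist u -> ld X u = 0).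
Proof.
rewrite memv_ker lfunE /= cobound_mk -mk0; split=> [/eqP | X0].
  exact: mk_inj.
by apply/eqP/mk_ext.
Qed.

Lemma coboundaries_mk X : mk (ld X) \in coboundaries K.
Proof. by rewrite -cobound_mk -(lfunE (@cobound T K)) memv_img ?memvf. Qed.

Lemma coboundariesP f :
  reflect (exists X, f = mk (ld X)) (f \in coboundaries K).
Proof.
apply: (iffP idP) => [/memv_imgP[h _ ->] | [X ->]]; last exact: coboundaries_mk.
by exists (rd h); rewrite lfunE /= -{1}(mk_rd h) cobound_mk.
Qed.

Lemma tr_size P X w : size w != P -> tr P X w = 0.
Proof. by rewrite /tr => /negPf->. Qed.

Lemma tr_id P X w : (forall w, size w != P -> X w = 0) -> tr P X w = X w.
Proof. by move=> XP; rewrite /tr; case: eqVneq => // /XP. Qed.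

Lemma ld_tr P X u : ld (tr P X) u = tr P.+1 (ld X) u.
Proof.
rewrite /tr; elim: u P X => [|x u IH] P X //=.
rewrite eqSS; case: P => [|P].
  have -> : ld (sh x (tr 0 X)) u = ld (fun=> 0) u by apply: ld_ext.
  rewrite ld0 addr0; case: eqP => // /size0nil->; rewrite /= addr0 //.
have -> : ld (sh x (tr P.+1 X)) u = ld (tr P (sh x X)) u.
  by apply: ld_ext => w _; rewrite /tr /sh /= eqSS.
by rewrite IH; case: eqP => _ //; rewrite addr0.
Qed.

Lemma cocycle_tr P X : mk X \in cocycles K -> mk (tr P X) \in cocycles K.
Proof.
move/cocycles_mk => X0; apply/cocycles_mk => u uK; rewrite ld_tr /tr X0 //.
by case: ifP.
Qed.
End Cochains.

(** * Steenrod operations on cohomology classes *)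

Section Classes.
Variables (T : finType) (K : complex T).
Implicit Types (X Y Z : seq T -> 'F_2) (u w : seq T) (f g : cochain K).
Notation mk := (mk K).
Notation klist := (klist K).
Notation Zc := (cocycles K).
Notation Bc := (coboundaries K).

Fact coh_class_is_linear : linear (@coh_class T K).
Proof. by move=> a f g; rewrite /coh_class !linearP. Qed.

HB.instance Definition _ :=
  GRing.isLinear.Build _ _ _ _ (@coh_class T K) coh_class_is_linear.

Lemma vsval_cocycle (x : coh_space K) : vsval x \in Zc.
Proof. exact: subvP (diffvSl _ _) _ (subvsP x). Qed.

Lemma coh_class_val (x : coh_space K) : coh_class (vsval x) = x.
Proof.
apply: subvs_inj; rewrite vsprojK; last exact: memv_pi.
by rewrite daddv_pi_id ?capv_diff ?subvsP.
Qed.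

Lemma coh_class_eqP f g : f \in Zc -> g \in Zc ->
  reflect (coh_class f = coh_class g) (f + g \in Bc).
Proof.
by move=> fZ gZ; rewrite -[X in f + X]oppr_F2 -coh_class_eq //; apply: eqP.
Qed.

Lemma coh_class0 f : f \in Bc -> coh_class f = 0.
Proof.
move=> fB; rewrite -(linear0 (@coh_class T K)); apply/coh_class_eqP; last by rewrite addr0.
  exact: subvP (@coboundaries_sub T K) _ fB.
exact: mem0v.
Qed.

(** For closed arguments, Steenrod's formula exhibits the commutator of a cup-i product as the
    coboundary of the cup-(i+1) product. *)
Lemma cupn_comm n X Y : mk X \in Zc -> mk Y \in Zc ->
  mk (cupn n X Y) + mk (cupn n Y X) \in Bc.
Proof.
move=> /cocycles_mk X0 /cocycles_mk Y0; rewrite -mkD.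
apply/coboundariesP; exists (cupn n.+1 X Y); apply: mk_ext => u uK.
have := ld_cupn n.+1 X Y u.
rewrite (cupn0l _ (f := ld X)) ?(cupn0r _ _ (g := ld Y)) ?addr0
  => [<- // | w wu | w wu].
  by rewrite Y0 // (klist_sub wu uK).
by rewrite X0 // (klist_sub wu uK).
Qed.

(** The coboundary of X cup_i dX is dX cup_i dX together with X cup_(i-1) dX + dX cup_(i-1) X, and
    the latter sum is the coboundary of X cup_(i-1) X. For [n = 0] the extra sum is absent. *)
Lemma cupn_cobound n X : mk (cupn n (ld X) (ld X)) \in Bc.
Proof.
have ldd w : ld (ld X) w = 0 by apply: ldK F2_addrr.
case: n => [|n]; apply/coboundariesP.
  exists (cupn 0 X (ld X)); apply: mk_ext => u _.
  have := ld_cupn 0 X (ld X) u; rewrite (cupn0r _ _ (g := ld (ld X))) // addr0.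
  by move/eqP; rewrite addr_eq0 (oppr_F2 (V := ('F_2)^o)) => /eqP.
exists (fun u => cupn n.+1 X (ld X) u + cupn n X X u); apply: mk_ext => u _.
rewrite ldD; have := ld_cupn n.+1 X (ld X) u; have := ld_cupn n X X u.
rewrite (cupn0r _ _ (g := ld (ld X))) // addr0.
set a := ld _ u; set b := ld _ u; set c := cupn n X (ld X) u.
set d := cupn n (ld X) X u; set e := cupn n.+1 _ _ u => h1 h2.
have {}h1 : a + d + c = 0 by rewrite h1; case: (n) => // n'; rewrite F2_addrr.
have -> : e = b + (c + d) by rewrite -h2 addrA F2_addrr add0r.
rewrite -[LHS]addr0 -h1.
have -> : b + (c + d) + (a + d + c) = b + a + ((c + d) + (c + d)) by ring.
by rewrite F2_addrr addr0.
Qed.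

Lemma cupn_closed n X : mk X \in Zc -> mk (cupn n X X) \in Zc.
Proof.
move=> /cocycles_mk X0; apply/cocycles_mk => u uK.
have := ld_cupn n X X u.
rewrite (cupn0l _ (f := ld X)) ?(cupn0r _ _ (g := ld X)) ?addr0
  => [-> | w wu | w wu].
- by case: n => // n; rewrite F2_addrr.
- by rewrite X0 // (klist_sub wu uK).
- by rewrite X0 // (klist_sub wu uK).
Qed.

Lemma cochain_Sq_mk k X : (0 < k)%N -> cochain_Sq k (mk X) =
  \sum_(k <= p < #|T|) mk (cupn (p - k).+1 (tr p.+1 X) (tr p.+1 X)).
Proof.
case: k => // k _; apply: eq_bigr => p _.
by rewrite !component_mk cup_mk.
Qed.

Lemma cochain_Sq_cocycle k f : f \in Zc -> cochain_Sq k f \in Zc.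
Proof.
case: k => // k; rewrite -(mk_rd f) cochain_Sq_mk // => fZ.
by apply: rpred_sum => p _; apply/cupn_closed/cocycle_tr.
Qed.

(** The squares are additive only up to their cross terms, which are commutators and so coboundaries
    by [cupn_comm]. *)
Lemma cochain_SqD k f g : f \in Zc -> g \in Zc ->
  cochain_Sq k (f + g) + (cochain_Sq k f + cochain_Sq k g) \in Bc.
Proof.
case: k => [_ _|k]; first by rewrite addrr_F2 mem0v.
rewrite -(mk_rd f) -(mk_rd g) -mkD !cochain_Sq_mk // => fZ gZ.
rewrite -!big_split /=; apply: rpred_sum => p _.
set X := tr p.+1 (rd f); set Y := tr p.+1 (rd g); set n := (_ - _).+1.
have -> : mk (cupn n (tr p.+1 (fun u => rd f u + rd g u))
                     (tr p.+1 (fun u => rd f u + rd g u))) =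
    mk (cupn n X X) + mk (cupn n Y Y) + (mk (cupn n X Y) + mk (cupn n Y X)).
  rewrite -!mkD; apply: mk_ext => u _.
  have e w : tr p.+1 (fun u => rd f u + rd g u) w = X w + Y w.
    by rewrite /X /Y /tr; case: ifP; rewrite ?addr0.
  rewrite (cupn_ext _ (fun w _ => e w) (fun w _ => e w)) cupnDl !cupnDr.
  by ring.
rewrite addrAC addrr_F2 add0r.
by apply: cupn_comm; apply: cocycle_tr.
Qed.

Lemma cochain_Sq_cobound k f : f \in Bc -> cochain_Sq k f \in Bc.
Proof.
move=> /coboundariesP[X ->]; case: k => [|k]; first exact: coboundaries_mk.
rewrite cochain_Sq_mk //; apply: rpred_sum => p _.
have -> : mk (cupn (p - k.+1).+1 (tr p.+1 (ld X)) (tr p.+1 (ld X))) =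
    mk (cupn (p - k.+1).+1 (ld (tr p X)) (ld (tr p X))).
  by apply: mk_ext => u _; apply: cupn_ext => w _; rewrite ld_tr.
exact: cupn_cobound.
Qed.

(** [Sq] is computed on the representative chosen by [vsval]. It differs from [f] by a coboundary,
    which [cochain_SqD] splits off and [cochain_Sq_cobound] discards. *)
Lemma Sq_class k f : f \in Zc ->
  Sq (s := redcoh K) k (coh_class f) = coh_class (cochain_Sq k f).
Proof.
move=> fZ; rewrite /=; set g := vsval _.
have gZ : g \in Zc by apply: vsval_cocycle.
have gfB : g + f \in Bc by apply/coh_class_eqP; rewrite // coh_class_val.
have gfZ : g + f \in Zc by rewrite rpredD.
apply/coh_class_eqP; try exact: cochain_Sq_cocycle.
have := rpredD (cochain_SqD k gfZ fZ) (cochain_Sq_cobound k gfB).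
by rewrite -[g + f + f]addrA addrr_F2 addr0 -addrA [_ + _ + _]addrAC addrr_F2 add0r.
Qed.

Lemma redcoh_SqD k (x y : redcoh K) : Sq k (x + y) = Sq k x + Sq k y.
Proof.
have xZ := vsval_cocycle x; have yZ := vsval_cocycle y.
rewrite -(coh_class_val x) -(coh_class_val y) -linearD !Sq_class ?rpredD //.
rewrite -[RHS](linearD (@coh_class T K)).
apply/coh_class_eqP; last exact: cochain_SqD.
  by apply: cochain_Sq_cocycle; rewrite rpredD.
by rewrite rpredD // cochain_Sq_cocycle.
Qed.

(** Cochains on faces with [P] vertices have degree p = P - 1, so cup_(p-k) has the shifted index
    [P - k]. The boundary case [k = P] is also correct: [cupn 0] multiplies by [X [::]], which is
    zero for [P > 0], while [P = 0] gives Sq^0 in degree -1. Thus no separate case is needed in the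
    Cartan sum. *)
Definition sq P k X : seq T -> 'F_2 :=
  if (k <= P)%N then cupn (P - k) X X else fun=> 0.

Definition supp (P : nat) X := forall w, size w != P -> X w = 0.

Lemma Sq_mk P k X : supp P X -> mk X \in Zc ->
  Sq (s := redcoh K) k (coh_class (mk X)) = coh_class (mk (sq P k X)).
Proof.
move=> XP XZ; rewrite Sq_class //; congr coh_class.
case: k => [|k]; first by apply: mk_ext => u _; rewrite /sq /= subn0 cupn_diag.
rewrite cochain_Sq_mk // /sq.
have tr0 p : p.+1 != P -> forall w, tr p.+1 X w = 0.
  by move=> pP w; rewrite /tr; case: eqP => // wp; apply: XP; rewrite wp.
have trP w : tr P X w = X w by apply: tr_id.
have other p : p.+1 != P -> mk (cupn (p - k.+1).+1 (tr p.+1 X) (tr p.+1 X)) = 0.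
  by move=> pP; rewrite -(mk0 K); apply: mk_ext => u _; apply: cupn0l => w _; apply: tr0.
(* The sum defining [cochain_Sq] stops at [#|T|]; past this bound there are no faces with [P]
   vertices. *)
have Xbig : (#|T| < P)%N -> forall u, klist u -> X u = 0.
  move=> TP u /andP[/size_subseq uT _]; apply: XP.
  by rewrite cardE in TP; rewrite neq_ltn (leq_ltn_trans uT TP).
case: leqP => kP.
  rewrite mk0 big_nat big1 // => p /andP[kp _]; apply: other; lia.
case: P => // p in XP tr0 trP other Xbig kP *.
case: (ltnP p #|T|) => pT; last first.
  rewrite big_nat big1 => [|q /andP[_ qT]]; last by apply: other; lia.
  rewrite -(mk0 K); apply/esym/mk_ext => u uK; apply: cupn0l => w wu.
  by apply: Xbig; [lia|apply: klist_sub uK].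
case: (leqP k.+1 p) => kp; last first.
  have {kP kp} ekp : k = p by lia.
  subst k.
  rewrite big_nat big1 => [|q /andP[kq _]]; last by apply: other; lia.
  rewrite subnn -(mk0 K); apply/esym/mk_ext => u uK.
  by rewrite cupn0 XP ?mul0r.
rewrite (bigD1_seq p) /= ?mem_index_iota ?iota_uniq ?kp //.
rewrite big1 => [|q qp]; last by apply: other; rewrite eqSS.
rewrite addr0 subSn //; apply: mk_ext => u _; apply: cupn_ext => w _; exact: trP.
Qed.
End Classes.

(** * Graded modules with Steenrod operations *)

Definition linear_map (U V : lmodType 'F_2) (f : U -> V) (fl : linear f) :
    {linear U -> V} :=
  HB.pack f (GRing.isLinear.Build _ _ _ _ f fl).

Lemma sum_linear (U V : lmodType 'F_2) (f : U -> V) (fl : linear f)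
    (I : Type) (r : seq I) (F : I -> U) :
  f (\sum_(i <- r) F i) = \sum_(i <- r) f (F i).
Proof. exact: (linear_sum (linear_map fl)). Qed.

Lemma linear_atD (U V : lmodType 'F_2) (f : U -> V) x y :
  linear f -> f (x + y) = f x + f y.
Proof. by move=> fl; have := fl 1 x y; rewrite !scale1r. Qed.

Lemma linear_at0 (U V : lmodType 'F_2) (f : U -> V) : linear f -> f 0 = 0.
Proof. by move=> fl; apply: (linear0 (linear_map fl)). Qed.

Lemma F2_cases (a : 'F_2) : a = 0 \/ a = 1.
Proof. by case: a => -[|[|//]] i; [left|right]; apply: val_inj. Qed.

Lemma linear_F2 (U V : lmodType 'F_2) (f : U -> V) :
  (forall x y, f (x + y) = f x + f y) -> linear f.
Proof.
move=> fD a x y; rewrite fD; congr (_ + _).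
have f0 : f 0 = 0 by apply: (addrI (f 0)); rewrite -fD !addr0.
by case: (F2_cases a) => ->; rewrite ?scale0r ?scale1r.
Qed.

Section Tens.
Variables V W : vectType 'F_2.

Lemma tens_ext (U : lmodType 'F_2) (f g : tens_space V W -> U) :
    linear f -> linear g -> (forall v w, f (pure v w) = g (pure v w)) ->
  f =1 g.
Proof.
move=> fl gl fg t; rewrite [t]tens_span.
rewrite -[f _]/(linear_map fl _) -[g _]/(linear_map gl _) !linear_sum.
apply: eq_bigr => i _; rewrite !linear_sum; apply: eq_bigr => j _.
by rewrite !linearZ /= fg.
Qed.

Lemma tens_lift_linear (U : vectType 'F_2) (h : V -> W -> U) :
  linear (tens_lift h).
Proof.
move=> a s t; rewrite /tens_lift scaler_sumr -big_split; apply: eq_bigr => i _.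
rewrite /= scaler_sumr -big_split; apply: eq_bigr => j _.
by rewrite /= !mxE scalerDl scalerA.
Qed.

Lemma pure_linearl (w : W) : linear (fun v : V => pure v w).
Proof.
by move=> a v v'; apply/matrixP => i j; rewrite !mxE linearP mulrDl mulrA.
Qed.

Lemma pure_linearr (v : V) : linear (fun w : W => pure v w).
Proof.
by move=> a w w'; apply/matrixP => i j; rewrite !mxE linearP mulrDr mulrCA.
Qed.

Lemma pure_suml (I : Type) (r : seq I) (F : I -> V) (w : W) :
  pure (\sum_(i <- r) F i) w = \sum_(i <- r) pure (F i) w.
Proof. exact: (linear_sum (linear_map (pure_linearl w))). Qed.

Lemma pure_sumr (I : Type) (r : seq I) (v : V) (F : I -> W) :
  pure v (\sum_(i <- r) F i) = \sum_(i <- r) pure v (F i).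
Proof. exact: (linear_sum (linear_map (pure_linearr v))). Qed.

Lemma pureDl v v' (w : W) : pure (v + v') w = pure v w + pure v' w :> tens_space V W.
Proof. by have := pure_linearl w 1 v v'; rewrite !scale1r. Qed.

Lemma pureZl a v (w : W) : pure (a *: v) w = a *: pure v w :> tens_space V W.
Proof. by apply/matrixP => i j; rewrite !mxE linearZ mulrA. Qed.
Lemma pureZr a (v : V) w : pure v (a *: w) = a *: pure v w :> tens_space V W.
Proof. by apply/matrixP => i j; rewrite !mxE linearZ mulrCA. Qed.
End Tens.

Definition spanned (M : sqModule) (x : M) : Prop :=
  exists2 s : seq (int * M), x = \sum_(p <- s) p.2 &
    forall p, p \in s -> homog p.1 p.2.

(** Properties of graded modules with additive operations that the record [sqModule] does not
    impose. *)
Record graded (M : sqModule) : Prop := Graded {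
  homog0 : forall n, homog n (0 : M);
  homogD : forall n (x y : M), homog n x -> homog n y -> homog n (x + y);
  homog_span : forall x : M, spanned x;
  SqD : forall k (x y : M), Sq k (x + y) = Sq k x + Sq k y }.

Lemma homog_sum (M : sqModule) (I : Type) (r : seq I) (P : pred I)
    (F : I -> M) n : graded M ->
  (forall i, P i -> homog n (F i)) -> homog n (\sum_(i <- r | P i) F i).
Proof.
move=> gM hF; elim/big_rec: _ => [|i x Pi hx]; first exact: homog0 gM _.
by apply: homogD gM _ _ _ _ hx; apply: hF.
Qed.

Lemma spannedD (M : sqModule) (x y : M) : spanned x -> spanned y -> spanned (x + y).
Proof.
move=> [s -> sh] [t -> th]; exists (s ++ t); rewrite ?big_cat // => p.
by rewrite mem_cat => /orP[/sh|/th].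
Qed.

Lemma spanned0 (M : sqModule) : spanned (0 : M).
Proof. by exists [::]; rewrite ?big_nil. Qed.

Lemma spanned_sum (M : sqModule) (I : Type) (r : seq I) (F : I -> M) :
  (forall i, spanned (F i)) -> spanned (\sum_(i <- r) F i).
Proof.
move=> hF; elim/big_rec: _ => [|i x _ hx]; first exact: spanned0.
exact: spannedD.
Qed.

Lemma spanned_homog (M : sqModule) n (x : M) : homog n x -> spanned x.
Proof.
by move=> hx; exists [:: (n, x)]; rewrite ?big_seq1 // => p; rewrite inE => /eqP->.
Qed.

Lemma Sq_linear M k : graded M -> linear (@Sq M k).
Proof. by move=> gM; apply/linear_F2/(SqD gM). Qed.

Lemma graded_susp M : graded M -> graded (susp M).
Proof.
move=> gM; split=> [n|n x y|x|k x y] /=.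
- exact: homog0 gM _.
- exact: homogD gM _ _ _.
- have [s -> sh] := homog_span gM x.
  exists [seq (p.1 + 1, p.2) | p <- s]; first by rewrite big_map.
  by move=> _ /mapP[p ps ->] /=; rewrite addrK; apply: sh.
- exact: SqD gM _ _ _.
Qed.

Lemma homog_pure (M N : sqModule) a b (x : M) (y : N) :
  homog a x -> homog b y -> homog (s := tens M N) (a + b) (pure x y).
Proof.
move=> hx hy; exists [:: (x, y)]; rewrite ?big_seq1 // => p.
by rewrite inE => /eqP->; exists a, b.
Qed.

Lemma graded_tens M N : graded M -> graded N -> graded (tens M N).
Proof.
move=> gM gN; split=> [n|n x y|x|k x y].
- by exists [::]; rewrite ?big_nil.
- move=> [s -> sh] [t -> th]; exists (s ++ t); rewrite ?big_cat // => p.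
  by rewrite mem_cat => /orP[/sh|/th].
- rewrite [x]tens_span; apply: spanned_sum => i; apply: spanned_sum => j.
  rewrite -pureZl; set v := _ *: _; set w := (_`_j).
  have [s -> sh] := homog_span gM v; have [t -> th] := homog_span gN w.
  rewrite pure_suml big_seq; elim/big_rec: _ => [|p z ps hz].
    exact: spanned0.
  apply: spannedD hz; rewrite pure_sumr big_seq; elim/big_rec: _ => [|q z' qt hz'].
    exact: spanned0.
  by apply: spannedD hz'; apply: spanned_homog (homog_pure (sh _ ps) (th _ qt)).
- by have := tens_lift_linear (fun (u : M) (v : N) =>
    \sum_(i < k.+1) pure (Sq i u) (Sq (k - i) v)) 1 x y; rewrite !scale1r.
Qed.

Lemma Sq_pure (M N : sqModule) k (x : M) (y : N) : graded M -> graded N ->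
  Sq (s := tens M N) k (pure x y) =
  \sum_(i < k.+1) pure (Sq i x) (Sq (k - i) y).
Proof.
move=> gM gN; apply: tens_lift_pure => [w | v] a u u'.
  rewrite scaler_sumr -big_split; apply: eq_bigr => i _ /=.
  by rewrite Sq_linear // pure_linearl.
rewrite scaler_sumr -big_split; apply: eq_bigr => i _ /=.
by rewrite Sq_linear // pure_linearr.
Qed.

Definition iso_pair (M N : sqModule) (f : M -> N) (g : N -> M) : Prop :=
  [/\ linear f /\ linear g, cancel f g, cancel g f,
      (forall n x, homog n x -> homog n (f x)) /\
      (forall n y, homog n y -> homog n (g y))
    & forall k x, f (Sq k x) = Sq k (f x)].

Lemma steenrod_isoP M N :
  steenrod_iso M N <-> exists f g, @iso_pair M N f g.
Proof.
split=> [[phi [[g fK gK] ph pS]] | [f [g [[fl gl] fK gK [fh gh] fS]]]].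
  exists phi, g; split=> //.
  - split; first exact: linearP.
    exact: (@can2_linear _ _ _ phi g fK gK).
  - by split=> n x => [/ph//|hx]; apply/ph; rewrite gK.
exists (linfun (linear_map fl)); split=> [|n x|k x].
- by exists g => x; rewrite lfunE /= ?fK ?gK.
- by rewrite lfunE /=; split=> [/fh //|/gh]; rewrite fK.
- by rewrite !lfunE /= fS.
Qed.

Lemma steenrod_iso_sym M N : steenrod_iso M N -> steenrod_iso N M.
Proof.
move=> /steenrod_isoP[f [g [[fl gl] fK gK [fh gh] fS]]]; apply/steenrod_isoP.
by exists g, f; split=> // k y; apply: (can_inj fK); rewrite gK fS gK.
Qed.

Lemma steenrod_iso_trans M N P :
  steenrod_iso M N -> steenrod_iso N P -> steenrod_iso M P.
Proof.
move=> /steenrod_isoP[f [g [[fl gl] fK gK [fh gh] fS]]].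
move=> /steenrod_isoP[f' [g' [[fl' gl'] fK' gK' [fh' gh'] fS']]].
apply/steenrod_isoP; exists (f' \o f), (g \o g'); split=> /=.
- split=> a x y /=; first by rewrite fl fl'.
  by rewrite gl' gl.
- exact: can_comp.
- exact: can_comp.
- by split=> n x => [/fh/fh'|/gh'/gh].
- by move=> k x; rewrite fS fS'.
Qed.

Lemma steenrod_iso_refl M : steenrod_iso M M.
Proof. by apply/steenrod_isoP; exists id, id; split. Qed.

Lemma steenrod_iso_susp M N : steenrod_iso M N -> steenrod_iso (susp M) (susp N).
Proof.
move=> /steenrod_isoP[f [g [fl fK gK [fh gh] fS]]]; apply/steenrod_isoP.
by exists f, g; split=> //; split=> n x; [apply: fh | apply: gh].
Qed.

Lemma steenrod_iso_tens M M' N N' :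
    graded M -> graded M' -> graded N -> graded N' ->
    steenrod_iso M M' -> steenrod_iso N N' ->
  steenrod_iso (tens M N) (tens M' N').
Proof.
move=> gM gM' gN gN'.
move=> /steenrod_isoP[f [f' [[fl fl'] fK fK' [fh fh'] fS]]].
move=> /steenrod_isoP[g [g' [[gl gl'] gK gK' [gh gh'] gS]]].
have lift_pure (A B A' B' : sqModule) (p : A -> A') (q : B -> B') :
    linear p -> linear q -> forall x y,
    tens_lift (fun x y => pure (p x) (q y) : tens_space A' B') (pure x y) =
    pure (p x) (q y).
  move=> pl ql; apply: tens_lift_pure => [w|v] a u u'.
    by rewrite pl pure_linearl.
  by rewrite ql pure_linearr.
have lift_homog (A B A' B' : sqModule) (p : A -> A') (q : B -> B') :
    linear p -> linear q -> (forall n x, homog n x -> homog n (p x)) ->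
    (forall n x, homog n x -> homog n (q x)) -> forall n (t : tens A B),
    homog n t ->
    homog (s := tens A' B') n (tens_lift (fun x y => pure (p x) (q y)) t).
  move=> pl ql ph qh n t [s -> sh]; exists [seq (p x.1, q x.2) | x <- s].
    rewrite big_map (sum_linear (tens_lift_linear _)).
    by apply: eq_bigr => x _; apply: lift_pure.
  move=> _ /mapP[x xs ->] /=; have [a [b [<- ha hb]]] := sh _ xs.
  by exists a, b; split=> //; [apply: ph | apply: qh].
have lift_can (A B A' B' : sqModule) (p : A -> A') (q : B -> B')
    (p' : A' -> A) (q' : B' -> B) : linear p -> linear q ->
    linear p' -> linear q' -> cancel p p' -> cancel q q' ->
    cancel (tens_lift (fun x y => pure (p x) (q y) : tens_space A' B'))
           (tens_lift (fun x y => pure (p' x) (q' y) : tens_space A B)).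
  move=> pl ql pl' ql' pK qK; apply: tens_ext.
  - by move=> a x y; rewrite !tens_lift_linear.
  - by [].
  - by move=> x y; rewrite !lift_pure ?pK ?qK.
apply/steenrod_isoP.
exists (tens_lift (fun x y => pure (f x) (g y))),
       (tens_lift (fun x y => pure (f' x) (g' y))); split.
- by split; apply: tens_lift_linear.
- exact: lift_can.
- exact: lift_can.
- by split; apply: lift_homog.
move=> k; apply: tens_ext.
- move=> a x y; rewrite (Sq_linear _ (graded_tens gM gN)).
  exact: tens_lift_linear.
- move=> a x y; rewrite tens_lift_linear.
  exact: (Sq_linear _ (graded_tens gM' gN')).
move=> x y; rewrite Sq_pure // lift_pure // Sq_pure //.
rewrite (sum_linear (tens_lift_linear _)).
by apply: eq_bigr => i _; rewrite -fS -gS; apply: lift_pure.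
Qed.

(** The underlying space and operations are the same; only the degrees of the left factors are
    relabelled. *)
Lemma tens_susp M N : steenrod_iso (tens (susp M) N) (susp (tens M N)).
Proof.
apply/steenrod_isoP; exists id, id; split=> //=; split=> n t [s -> sh]; exists s => // p.
  move=> /sh[a [b [<- ha hb]]]; exists (a - 1), b; split=> //.
  by rewrite addrAC.
move=> /sh[a [b [e ha hb]]]; exists (a + 1), b; split=> //=.
  by rewrite addrAC e subrK.
by rewrite addrK.
Qed.

Section Foldl.
Variables (I : Type) (N : I -> sqModule).
Hypothesis gN : forall i, graded (N i).

Lemma graded_foldl M s : graded M -> graded (foldl tens M [seq N i | i <- s]).
Proof. by elim: s M => //= i s IH M gM; apply/IH/graded_tens. Qed.

Lemma steenrod_iso_foldl M M' s : graded M -> graded M' -> steenrod_iso M M' ->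
  steenrod_iso (foldl tens M [seq N i | i <- s]) (foldl tens M' [seq N i | i <- s]).
Proof.
elim: s M M' => //= i s IH M M' gM gM' MM'; apply: IH; try exact: graded_tens.
by apply: steenrod_iso_tens => //; apply: steenrod_iso_refl.
Qed.

Lemma foldl_susp M s : graded M ->
  steenrod_iso (susp (foldl tens M [seq N i | i <- s]))
               (foldl tens (susp M) [seq N i | i <- s]).
Proof.
elim: s M => /= [|i s IH] M gM; first exact: steenrod_iso_refl.
apply: steenrod_iso_trans (IH _ (graded_tens gM (gN i))) _.
apply: steenrod_iso_foldl; last exact/steenrod_iso_sym/tens_susp.
  exact/graded_susp/graded_tens.
exact/graded_tens/gN/graded_susp.
Qed.
End Foldl.

(** * Maps in cohomology *)

(** Independence of the homogeneous parts, which [spanned] does not provide. It serves to show that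
    the inverse of a degree-preserving bijection preserves degrees. *)
Definition homog_proj (M : sqModule) : Prop :=
  forall n, exists pr : M -> M, [/\ linear pr, forall x, homog n x -> pr x = x
    & forall d x, d != n -> homog d x -> pr x = 0].

Lemma steenrod_isoI (M N : sqModule) (f : M -> N) :
    graded M -> graded N -> homog_proj N -> linear f -> bijective f ->
    (forall n x, homog n x -> homog n (f x)) ->
    (forall k n x, homog n x -> f (Sq k x) = Sq k (f x)) ->
  steenrod_iso M N.
Proof.
move=> gM gN pN fl [g fK gK] fh fS; apply/steenrod_isoP; exists f, g.
have gl : linear g by apply: (@can2_linear _ _ _ (linear_map fl) g fK gK).
split=> //.
  split=> // n y hy; have [pr [prl pr1 pr0]] := pN n.
  have [s gy sh] := homog_span gM (g y).
  (* Projecting the image of the decomposition to degree [n] keeps [y] and kills the images of all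
     parts of other degrees, so the parts of degree [n] already map to [y]. *)
  have -> : g y = \sum_(p <- s | p.1 == n) p.2.
    apply: (can_inj fK); rewrite gK -(pr1 _ hy) -{1}[y]gK gy.
    rewrite (sum_linear fl) (sum_linear prl) -[in RHS]big_filter (sum_linear fl).
    rewrite big_filter big_seq [RHS]big_mkcond [RHS]big_seq.
    apply: eq_bigr => p ps; case: eqVneq => [pn|pn].
      by apply: pr1; rewrite -pn; apply/fh/sh.
    by apply: (pr0 _ _ pn); apply/fh/sh.
  rewrite big_seq_cond; apply: homog_sum => // p /andP[ps /eqP <-].
  exact: sh.
move=> k x; have [s -> sh] := homog_span gM x.
rewrite (sum_linear (Sq_linear k gM)) !(sum_linear fl).
rewrite (sum_linear (Sq_linear k gN)) big_seq [RHS]big_seq.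
by apply: eq_bigr => p /sh; apply: fS.
Qed.

(** * The grading of reduced cohomology *)

Section Graded.
Variables (T : finType) (K : complex T).
Notation mk := (mk K).
Notation klist := (klist K).
Implicit Types (X Y Z : seq T -> 'F_2).

Lemma homog_cls P X : supp P X -> mk X \in cocycles K ->
  homog (s := redcoh K) (P%:Z - 1) (coh_class (mk X)).
Proof.
move=> XP XZ; exists (mk X); split=> // s; rewrite ffunE => Xs.
rewrite subrK; congr Posz; apply/eqP; rewrite cardE.
by apply: contraNT Xs => /XP->.
Qed.

Lemma homog_clsP n (x : redcoh K) : homog n x ->
  x = 0 \/ exists P X, [/\ n = P%:Z - 1, supp P X, mk X \in cocycles K
                         & x = coh_class (mk X)].
Proof.
(* A negative [n + 1] is not a number of vertices; in such degrees only the zero cochain is left. *)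
move=> [f [fZ fn ->]]; case en: (n + 1) => [P|q].
  right; exists P, (tr P (rd f)).
  have e : mk (tr P (rd f)) = f.
    rewrite -[RHS]mk_rd; apply: mk_ext => u /andP[uT uK].
    rewrite /tr; case: eqP => // uP; apply/esym/eqP; rewrite /rd.
    rewrite -[[set x in u]]/(val (Sub [set x in u] uK : face K)) value_face.
    apply: contraT => /fn; rewrite en /= => -[] e; case: uP; rewrite -e.
    by rewrite cardE enum_list.
  by rewrite e; split=> //; [rewrite -en addrK | move=> w; apply: tr_size].
left; have -> : f = 0.
  apply/ffunP => s; rewrite ffunE; apply/eqP; apply: contraT => /fn.
  by rewrite en.
exact: linear0.
Qed.

Lemma redcoh_span (x : redcoh K) : spanned x.
Proof.
pose X := rd (vsval x).
have XZ : mk X \in cocycles K by rewrite mk_rd vsval_cocycle.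
have -> : x = \sum_(P < #|T|.+1) coh_class (mk (tr P X)).
  rewrite -(linear_sum (@coh_class T K)) -[LHS]coh_class_val; congr coh_class.
  rewrite -[LHS]mk_rd -/X; apply/ffunP => s; rewrite sum_ffunE ffunE.
  have sT : (size (enum (val s)) < #|T|.+1)%N by rewrite -cardE ltnS max_card.
  rewrite (bigD1 (Ordinal sT)) //= ffunE /tr eqxx big1 ?addr0 // => P PT.
  rewrite ffunE; case: eqP => // e; case/eqP: PT; exact: val_inj.
apply: spanned_sum => P; apply: spanned_homog (P%:Z - 1) _ _.
by apply: homog_cls; [move=> w; apply: tr_size | apply: cocycle_tr].
Qed.

Lemma graded_redcoh : graded (redcoh K).
Proof.
split.
- move=> n; exists 0; split; [exact: mem0v | | by rewrite linear0].
  by move=> s; rewrite ffunE eqxx.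
- move=> n x y [f [fZ fn ->]] [g [gZ gn ->]]; exists (f + g).
  split; [by rewrite rpredD | | by rewrite linearD].
  move=> s; rewrite ffunE; have := fn s; case: eqVneq => [->|_ h _]; last exact: h.
  by rewrite add0r => _; apply: gn.
- exact: redcoh_span.
- exact: redcoh_SqD.
Qed.

Lemma tr_ld P X : exists Y, forall w, tr P (ld X) w = ld Y w.
Proof.
case: P => [|P]; last by exists (tr P X) => w; rewrite ld_tr.
exists (fun=> 0) => w; rewrite ld0.
by rewrite /tr; case: eqP => // /size0nil->.
Qed.

(** The projection truncates representatives to faces with [n + 1] vertices; this is well defined on
    classes because [ld] shifts the number of vertices by one. *)
Lemma redcoh_proj : homog_proj (redcoh K).
Proof.
move=> n; case en: (n + 1) => [P|q]; last first.
  exists (fun=> 0); split=> // [a x y | x hx].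
    by rewrite scaler0 addr0.
  case: (homog_clsP hx) => // -[P [X [e _ _ _]]]; move: en.
  by rewrite e subrK.
pose pr (x : redcoh K) : redcoh K := coh_class (mk (tr P (rd (vsval x)))).
have prE X : mk X \in cocycles K ->
    pr (coh_class (mk X)) = coh_class (mk (tr P X)).
  move=> XZ; rewrite /pr; set f := vsval _.
  have fZ : f \in cocycles K by apply: vsval_cocycle.
  have : f + mk X \in coboundaries K.
    by apply/coh_class_eqP => //; rewrite coh_class_val.
  move=> /coboundariesP[Y eY]; apply/coh_class_eqP.
  - by apply: cocycle_tr; rewrite mk_rd.
  - exact: cocycle_tr.
  have [Z eZ] := tr_ld P Y; apply/coboundariesP; exists Z.
  rewrite -mkD; apply: mk_ext => u uK; rewrite -eZ /tr.
  case: ifP => _; last by rewrite addr0.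
  have e : mk (fun w => rd f w + X w) = mk (ld Y) by rewrite mkD mk_rd eY.
  exact: (mk_inj e).
have prl : linear pr.
  apply: linear_F2 => x y; rewrite /pr -linearD -mkD; congr coh_class.
  apply: mk_ext => u _; rewrite /tr; case: ifP => _; last by rewrite addr0.
  rewrite /rd /value.
  by case: insubP => [s _ _|_]; rewrite ?ffunE ?addr0.
have pr0 : pr 0 = 0 by exact: linear_at0 prl.
exists pr; split=> // [x hx | d x dn hx].
  case: (homog_clsP hx) => [->//|[Q [X [eQ XQ XZ ->]]]].
  rewrite prE //; congr coh_class; apply: mk_ext => u _; apply: tr_id.
  by move: en; rewrite eQ subrK => -[<-].
case: (homog_clsP hx) => [->//|[Q [X [eQ XQ XZ ->]]]].
rewrite prE // (_ : mk _ = 0) ?linear0 // -(mk0 K); apply: mk_ext => u _.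
rewrite /tr; case: eqP => // uP; apply: XQ; apply: contraNneq dn => uQ.
by rewrite eQ -uQ uP -en addrK.
Qed.
End Graded.

Section CohMap.
Variables (T T' : finType) (K : complex T) (K' : complex T').

Lemma coh_map (phi : (seq T -> 'F_2) -> seq T' -> 'F_2) :
    (forall X Y u, klist K' u ->
      phi (fun w => X w + Y w) u = phi X u + phi Y u) ->
    (forall X Y, mk K X = mk K Y -> mk K' (phi X) = mk K' (phi Y)) ->
    (forall X, mk K X \in cocycles K -> mk K' (phi X) \in cocycles K') ->
    (forall X, mk K' (phi (ld X)) \in coboundaries K') ->
  exists f : redcoh K -> redcoh K', linear f /\
    forall X, mk K X \in cocycles K ->
      f (coh_class (mk K X)) = coh_class (mk K' (phi X)).
Proof.
move=> phiD phi_ext phiZ phiB.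
pose f (x : redcoh K) : redcoh K' := coh_class (mk K' (phi (rd (vsval x)))).
have rdD g h u : rd (g + h) u = rd g u + rd h u :> 'F_2.
  rewrite /rd /value.
  by case: insubP => [s _ _|_]; rewrite ?ffunE ?addr0.
exists f; split.
  apply: linear_F2 => x y; rewrite /f -linearD -mkD; congr coh_class.
  rewrite -(mk_ext (phiD _ _)); apply: phi_ext; apply: mk_ext => u _.
  exact: rdD.
move=> X XZ; rewrite /f; set g := vsval _.
have gZ : g \in cocycles K by apply: vsval_cocycle.
have : g + mk K X \in coboundaries K.
  by apply/coh_class_eqP => //; rewrite coh_class_val.
move=> /coboundariesP[Y eY]; apply/coh_class_eqP.
- by apply: phiZ; rewrite mk_rd.
- exact: phiZ.
rewrite -mkD -(mk_ext (phiD _ _)) (phi_ext _ (ld Y)) ?phiB //.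
by rewrite -eY mkD mk_rd.
Qed.
End CohMap.

(** * Invariance under increasing relabellings *)

Section Relabel.
Variables (T T' : finType) (K : complex T) (K' : complex T') (e : T -> T').
Hypothesis e_inj : injective e.
Hypothesis e_mono : subseq (map e (enum T)) (enum T').
Hypothesis KK' : forall s : {set T'},
  s \in faces K' <-> exists2 t, t \in faces K & s = e @: t.

Let map_set (u : seq T) : [set x in map e u] = e @: [set x in u].
Proof.
apply/setP => y; rewrite inE; apply/mapP/imsetP => -[x xu ->]; exists x => //.
  by rewrite inE.
by rewrite inE in xu.
Qed.

Let klist_map u : klist K u -> klist K' (map e u).
Proof.
move=> /andP[uT uK]; rewrite /klist (subseq_trans (map_subseq e uT) e_mono).
by apply/KK'; rewrite map_set; exists [set x in u].
Qed.

Let klist_inv u' : klist K' u' -> exists2 u, klist K u & u' = map e u.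
Proof.
move=> /andP[uT /KK'[t tK eu]]; exists (enum t); first exact: klist_enum.
rewrite -(enum_list uT) eu -{1}(set_enum t) -map_set enum_list //.
exact: subseq_trans (map_subseq e (enum_set_sub t)) e_mono.
Qed.

Let inv (y : T') : option T := [pick x | e x == y].

Let mapK : cancel (map e) (pmap inv).
Proof.
apply: map_pK => x; rewrite /inv; case: pickP => [z /eqP/e_inj-> //|/(_ x)].
by rewrite eqxx.
Qed.

Let ld_map (X : seq T' -> 'F_2) u : ld (X \o map e) u = ld X (map e u).
Proof. by elim: u X => //= x u IH X; rewrite -IH. Qed.

Let ld_pmap (Y : seq T -> 'F_2) u : ld (Y \o pmap inv) (map e u) = ld Y u.
Proof. by rewrite -ld_map; apply: ld_ext => w _ /=; rewrite mapK. Qed.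

Let cupn_map n (X Y : seq T' -> 'F_2) u :
  cupn n (X \o map e) (Y \o map e) u = cupn n X Y (map e u).
Proof.
elim: u n X Y => [|x u IH] n X Y /=; first by rewrite !cupn_nil.
by rewrite !cupn_cons -IH; case: n => // n; rewrite -IH.
Qed.

(** As [e] is increasing, [map e] matches the increasing lists of both complexes. Pulling back along
    it commutes strictly with coboundaries and with the cup-i products, which depend on the vertex
    order. *)
Lemma redcoh_relabel : steenrod_iso (redcoh K) (redcoh K').
Proof.
apply: steenrod_iso_sym.
have [||||f [fl fE]] := @coh_map T' T K' K (fun X => X \o map e).
- by [].
- by move=> X Y XY; apply: mk_ext => u uK; apply: mk_inj XY _ (klist_map uK).
- move=> X /cocycles_mk X0; apply/cocycles_mk => u uK.
  by rewrite ld_map X0 // klist_map.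
- move=> X; apply/coboundariesP; exists (X \o map e); apply: mk_ext => u _.
  by rewrite ld_map.
have [||||g [gl gE]] := @coh_map T T' K K' (fun Y => Y \o pmap inv).
- by [].
- move=> X Y XY; apply: mk_ext => _ /klist_inv[u uK ->] /=.
  by rewrite mapK; apply: mk_inj XY _ uK.
- move=> X /cocycles_mk X0; apply/cocycles_mk => _ /klist_inv[u uK ->].
  by rewrite ld_pmap X0.
- move=> X; apply/coboundariesP; exists (X \o pmap inv).
  by apply: mk_ext => _ /klist_inv[u uK ->]; rewrite ld_pmap /= mapK.
have pullZ X : mk K' X \in cocycles K' -> mk K (X \o map e) \in cocycles K.
  move=> /cocycles_mk X0; apply/cocycles_mk => u uK.
  by rewrite ld_map X0 // klist_map.
have pushZ X : mk K X \in cocycles K -> mk K' (X \o pmap inv) \in cocycles K'.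
  move=> /cocycles_mk X0; apply/cocycles_mk => _ /klist_inv[u uK ->].
  by rewrite ld_pmap X0.
apply: (steenrod_isoI (f := f)) => //; try exact: graded_redcoh.
- exact: redcoh_proj.
- exists g => x; rewrite -(coh_class_val x) -(mk_rd (vsval x)).
    have xZ : mk K' (rd (vsval x)) \in cocycles K' by rewrite mk_rd vsval_cocycle.
    rewrite fE // gE; last exact: pullZ.
    by congr coh_class; apply: mk_ext => _ /klist_inv[u uK ->] /=; rewrite mapK.
  have xZ : mk K (rd (vsval x)) \in cocycles K by rewrite mk_rd vsval_cocycle.
  rewrite gE // fE; last exact: pushZ.
  by congr coh_class; apply: mk_ext => u _ /=; rewrite mapK.
- move=> n x /homog_clsP[->|[P [X [-> XP XZ ->]]]].
    by rewrite (linear_at0 fl); apply: (homog0 (graded_redcoh K)).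
  rewrite fE //; apply: homog_cls; last exact: pullZ.
  by move=> w wP; apply: XP; rewrite size_map.
move=> k n x /homog_clsP[->|[P [X [_ XP XZ ->]]]].
  by rewrite !(linear_at0 (Sq_linear k (graded_redcoh _)), linear_at0 fl).
have XP' : supp P (X \o map e) by move=> w wP; apply: XP; rewrite size_map.
rewrite fE // (Sq_mk _ XP XZ) (Sq_mk _ XP' (pullZ _ XZ)).
rewrite fE; last first.
  rewrite /sq; case: leqP => _; last by rewrite mk0 mem0v.
  exact: cupn_closed.
congr coh_class; apply: mk_ext => u _; rewrite /sq; case: leqP => kP /=; last by [].
by rewrite cupn_map.
Qed.
End Relabel.

(** * Contraction of a cone relative to a subcomplex *)

Lemma rdD (T : finType) (K : complex T) (f g : cochain K) u :
  rd (f + g) u = rd f u + rd g u.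
Proof.
rewrite /rd /value.
by case: insubP => [s _ _|_]; rewrite ?ffunE ?addr0.
Qed.

Lemma rdZ (T : finType) (K : complex T) c (f : cochain K) u :
  rd (c *: f) u = c * rd f u.
Proof.
rewrite /rd /value.
by case: insubP => [s _ _|_]; rewrite ?ffunE ?mulr0.
Qed.

Lemma rd_cobound (T : finType) (K : complex T) (f : cochain K) u :
  klist K u -> rd (cobound f) u = ld (rd f) u.
Proof. by move=> uK; rewrite -{1}(mk_rd f) cobound_mk rd_mk. Qed.

Section Contraction.
Variables (V : finType) (L D : complex V) (v : V).
Hypothesis LD : forall s, s \in faces L -> s \in faces D.
Hypothesis vD : forall s, s \in faces D -> v |: s \in faces D.

Definition restr (Z : cochain D) : cochain L := mk L (rd Z).
Definition extend (f : cochain L) : cochain D := mk D (rd f).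
Definition cone (Z : cochain D) : cochain D :=
  [ffun t : face D => if v \in val t then 0 else value Z (v |: val t)].

Let klistLD u : klist L u -> klist D u.
Proof. by move=> /andP[uV uL]; rewrite /klist uV LD. Qed.

Lemma restr_linear : linear restr.
Proof.
apply: linear_F2 => f g; rewrite /restr -mkD; apply: mk_ext => u _.
exact: rdD.
Qed.

Lemma extend_linear : linear extend.
Proof.
apply: linear_F2 => f g; rewrite /extend -mkD; apply: mk_ext => u _.
exact: rdD.
Qed.

Lemma cone_linear : linear cone.
Proof.
apply: linear_F2 => f g; apply/ffunP => s; rewrite !ffunE /value.
by case: ifP => _; rewrite ?addr0 //; case: insubP => [t _ _|_];
   rewrite ?ffunE ?addr0.
Qed.

Lemma extendK f : restr (extend f) = f.
Proof.
by rewrite -[RHS]mk_rd; apply: mk_ext => u uL; rewrite rd_mk // klistLD.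
Qed.

Lemma restr_cobound Z : restr (cobound Z) = cobound (restr Z).
Proof.
rewrite cobound_mk; apply: mk_ext => u uL; rewrite rd_cobound //.
exact: klistLD.
Qed.

(** On a face containing [v] only the deletion of [v] survives. On a face [t] without [v], deleting
    [v] from [v |: t] gives the value of [Z], and the remaining deletions cancel between the two
    terms. *)
Lemma cone_homotopy Z : cobound (cone Z) + cone (cobound Z) = Z.
Proof.
have value_cone (t : {set V}) : t \in faces D ->
    value (cone Z) t = if v \in t then 0 else value Z (v |: t).
  by move=> tD; rewrite -[t]/(val (Sub t tD : face D)) value_face ffunE.
apply/ffunP => s; rewrite !ffunE -(value_face Z); have := valP s.
move: (val s) => {s} /= t tD.
have sub u : t :\ u \in faces D by apply: complexS (subsetDl _ _) tD.
case: ifP => vt.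
  rewrite addr0 (bigD1 v) //= value_cone // setD11 setD1K // big1 ?addr0 //.
  by move=> u /andP[_ uv]; rewrite value_cone // !inE vt eq_sym uv.
rewrite value_cobound ?vD // [X in _ + X](bigD1 v) ?setU11 //= setU1K ?vt //.
rewrite addrCA [X in _ + X](_ : _ = 0) ?addr0 //.
rewrite [X in _ + X](eq_bigl (mem t)); last first.
  by move=> u; rewrite !inE; case: eqVneq => [->|]; rewrite ?vt //= andbT.
rewrite -big_split big1 // => u ut /=; rewrite value_cone // !inE vt andbF.
suff -> : (v |: t) :\ u = v |: (t :\ u) by rewrite F2_addrr.
apply/setP => x; rewrite !inE; case: eqVneq => [->|] //=.
by case: eqVneq => // uv; rewrite uv vt in ut.
Qed.

Let delta : 'End(cochain L) := linfun (@cobound V L).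
(** A linear right inverse of the coboundary on its image. With it [clos] projects onto the
    cocycles, and [contr] contracts the cochains of [L] onto the chosen representatives of
    classes. *)
Let pinv : 'End(cochain L) := (delta^-1)%VF.

Let deltaE f : delta f = cobound f. Proof. exact: lfunE. Qed.

Let pinvK f : cobound (pinv (cobound f)) = cobound f.
Proof. by rewrite -!deltaE limg_lfunVK ?memv_img ?memvf. Qed.

Let clos (f : cochain L) := f + pinv (cobound f).

Let clos_cocycle f : clos f \in cocycles L.
Proof.
by rewrite memv_ker -/delta deltaE linearD /= pinvK addrr_F2.
Qed.

Definition cls_part (f : cochain L) : coh_space L := coh_class (clos f).

Definition contr (f : cochain L) : cochain L :=
  pinv (clos f + vsval (cls_part f)).

Lemma cls_part_linear : linear cls_part.
Proof.
apply: linear_F2 => f g; rewrite /cls_part -linearD; congr coh_class.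
by rewrite /clos !linearD /= addrACA.
Qed.

Lemma contr_linear : linear contr.
Proof.
apply: linear_F2 => f g; rewrite /contr -linearD; congr (pinv _).
have -> : cls_part (f + g) = cls_part f + cls_part g.
  by have := cls_part_linear 1 f g; rewrite !scale1r.
by rewrite linearD /clos !linearD /= [RHS]addrACA; congr (_ + _); apply: addrACA.
Qed.

Lemma cls_part_cobound f : cls_part (cobound f) = 0.
Proof.
rewrite /cls_part /clos coboundK linear0 addr0; apply: coh_class0.
by apply/coboundariesP; exists (rd f); rewrite -cobound_mk mk_rd.
Qed.

Lemma cls_part_cocycle f : f \in cocycles L -> cls_part f = coh_class f.
Proof.
rewrite memv_ker -/delta deltaE => /eqP f0.
by rewrite /cls_part /clos f0 linear0 addr0.
Qed.

Lemma contr_homotopy f :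
  cobound (contr f) + contr (cobound f) = f + vsval (cls_part f).
Proof.
have -> : contr (cobound f) = pinv (cobound f).
  rewrite /contr cls_part_cobound linear0 addr0 /clos coboundK linear0.
  by rewrite addr0.
have : clos f + vsval (cls_part f) \in coboundaries L.
  by apply/coh_class_eqP; rewrite ?clos_cocycle ?vsval_cocycle // coh_class_val.
move=> B; rewrite /contr -deltaE limg_lfunVK // /clos.
by rewrite addrAC -[f + _ + _]addrA addrr_F2 addr0.
Qed.
Local Notation iota y := (extend (vsval y)).

(* [M] measures the failure of the contraction of [L] on [D]; it takes values in
   the cochains vanishing on [L], so that adding its composite with the
   contraction of the cone [D] does not disturb the homotopy on [L]. *)
Lemma relative_contraction :
  exists (kap : cochain D -> coh_space L) (H : cochain D -> cochain D),
  [/\ linear kap /\ linear H,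
      forall Z, kap (cobound Z) = cls_part (restr Z),
      forall y : coh_space L, kap (iota y) = 0,
      forall Z, cobound (H Z) + H (cobound Z) =
        Z + (iota (cls_part (restr Z)) + cobound (iota (kap Z)))
    & forall Z, restr Z = 0 -> restr (H Z) = 0].
Proof.
pose Q : {linear cochain D -> cochain D} := linear_map extend_linear \o
  linear_map contr_linear \o linear_map restr_linear.
pose i : {linear coh_space L -> cochain D} :=
  linear_map extend_linear \o @vsval _ _ _.
pose e : {linear cochain D -> cochain D} := i \o
  linear_map cls_part_linear \o linear_map restr_linear.
pose k : {linear cochain D -> cochain D} := linear_map cone_linear.
pose kap0 : {linear cochain D -> coh_space L} :=
  linear_map cls_part_linear \o linear_map restr_linear \o k.
pose M Z := Z + cobound (Q Z) + Q (cobound Z) + e Z.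
(* The correction [kap0 (e Z)] makes [kap] vanish on the representatives [iota y], which [e] fixes;
   the last term of [H] accounts for it in the homotopy. *)
pose kap Z := kap0 Z + kap0 (e Z).
pose H Z := Q Z + M (k Z) + i (kap0 (e Z)).
have e_d Z : e (cobound Z) = 0.
  by rewrite /e /= restr_cobound cls_part_cobound linear0 (linear_at0 extend_linear).
have kd Z : k (cobound Z) = Z + cobound (k Z).
  by rewrite /k /= -{2}(cone_homotopy Z) addrAC addrr_F2 add0r.
have kap0_d Z : kap0 (cobound Z) = cls_part (restr Z).
  rewrite -[kap0 _]/(cls_part (restr (k (cobound Z)))) kd.
  rewrite (linear_atD _ _ restr_linear) (linear_atD _ _ cls_part_linear).
  by rewrite /= restr_cobound cls_part_cobound addr0.
have add3 (U : zmodType) (x y z x' y' z' : U) :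
    (x + x') + (y + y') + (z + z') = (x + y + z) + (x' + y' + z').
  by rewrite [RHS]addrACA; congr (_ + _); apply: addrACA.
have MD x y : M (x + y) = M x + M y.
  by rewrite /M !linearD [RHS]addrACA; congr (_ + _); apply: add3.
have dD x y : cobound (x + y) = cobound x + cobound y :> cochain D.
  exact: linearD.
have dM Z : cobound (M (k Z)) =
    cobound (k Z) + cobound (Q (cobound (k Z))) + cobound (e (k Z)).
  by rewrite /M !linearD /= coboundK addr0.
have Md Z : M (cobound (k Z)) = cobound (k Z) + cobound (Q (cobound (k Z))).
  by rewrite /M coboundK linear0 addr0 e_d addr0.
exists kap, H; split.
- split; apply: linear_F2 => x y; first by rewrite /kap !linearD addrACA.
  by rewrite /H !linearD MD add3.
- by move=> Z; rewrite /kap e_d linear0 addr0 kap0_d.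
- move=> y; rewrite /kap.
  have -> : e (iota y) = iota y.
    rewrite -[LHS]/(i (cls_part (restr (iota y)))) extendK.
    by rewrite cls_part_cocycle ?vsval_cocycle // coh_class_val.
  exact: addrr_F2.
- move=> Z; rewrite /H e_d !linear0 addr0 kd MD 2!dD dM Md.
  have -> : cobound (iota (kap Z)) =
      cobound (e (k Z)) + cobound (i (kap0 (e Z))).
    by rewrite -linearD -(linearD i).
  rewrite -[iota (cls_part _)]/(e Z) /M.
  move: (cobound (Q Z)) (cobound (k Z)) (cobound (Q (cobound (k Z))))
    (cobound (e (k Z))) (cobound (i _)) (Q (cobound Z)) (e Z).
  move=> q a b c d q' e'; rewrite !addrA.
  rewrite [LHS](ACl ((1 * 8) * (2 * 11) * (3 * 12) * (6 * 9) * 7 * 10 * 4 * 5)) /=.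
  by rewrite !addrr_F2 !add0r.
move=> Z Z0; rewrite /H.
have eZ : e Z = 0.
  by rewrite /e /= Z0 (linear_at0 cls_part_linear) linear0 (linear_at0 extend_linear).
have QZ : Q Z = 0.
  by rewrite /Q /= Z0 (linear_at0 contr_linear) (linear_at0 extend_linear).
rewrite eZ QZ !linear0 add0r addr0 /M !(linear_atD _ _ restr_linear).
rewrite restr_cobound /Q /= !extendK restr_cobound.
move: (restr (k Z)) => f.
by rewrite -[f + _ + _]addrA contr_homotopy addrA addrr_F2 add0r addrr_F2.
Qed.
End Contraction.

(** * Replacing one vertex *)

Lemma subseq_catP (T : eqType) (u s1 s2 : seq T) : subseq u (s1 ++ s2) ->
  exists u1 u2, [/\ u = u1 ++ u2, subseq u1 s1 & subseq u2 s2].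
Proof.
elim: s1 u => [|x s1 IH] u /= us; first by exists [::], u.
case: u us => [|z u] us; first by exists [::], [::]; rewrite sub0seq.
move: us; case: eqVneq => [->|zx] /IH[u1 [u2 [e u1s u2s]]].
  by exists (x :: u1), u2; rewrite e /= eqxx.
by exists u1, u2; rewrite e; split=> //; apply: subseq_trans u1s (subseq_cons _ _).
Qed.

(** Turns the Cartan sum into a convolution of cup products: Sq^i on [P] vertices has shifted index
    [P - i], Sq^(k-i) on [Q] vertices has [Q - (k - i)], and these add up to [P + Q - k]. *)
Lemma sum_bidegree (M : nmodType) P Q k (A : nat -> nat -> M) : (k <= P + Q)%N ->
    (forall j l, (Q < j)%N || (P < l)%N -> A j l = 0) ->
  \sum_(i < k.+1 | (i <= P)%N && (k - i <= Q)%N) A (Q - (k - i))%N (P - i)%N =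
  \sum_(j < (P + Q - k).+1) A j (P + Q - k - j)%N.
Proof.
move=> kPQ A0; rewrite [RHS](bigID (fun j : 'I_ _ => (j <= Q)%N &&
  (P + Q - k - j <= P)%N)) /= [X in _ + X]big1 ?addr0; last first.
  by move=> j; rewrite negb_and -!ltnNge => /A0.
rewrite (reindex_onto (fun j : 'I_(P + Q - k).+1 => inord (j + k - Q) : 'I_k.+1)
   (fun i => inord (Q + i - k))) /=; last first.
  move=> i /andP[iP kiQ]; apply: val_inj; have := ltn_ord i => ik.
  by rewrite /= !inordK; lia.
have cond (j : 'I_(P + Q - k).+1) :
    ((inord (j + k - Q) : 'I_k.+1) <= P)%N &&
    (k - (inord (j + k - Q) : 'I_k.+1) <= Q)%N &&
    (inord (Q + (inord (j + k - Q) : 'I_k.+1) - k) == j) =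
    (j <= Q)%N && (P + Q - k - j <= P)%N.
  have := ltn_ord j => jk; rewrite -val_eqE /= !val_insubd /=.
  by do ?case: ifP; lia.
apply: eq_big => // j; rewrite cond => /andP[jQ nj].
by have := ltn_ord j => jk; congr A; rewrite val_insubd /=; case: ifP; lia.
Qed.

Section SimplexOn.
Variables (V : finType) (S : {set V}).
Fact simplex_on0 : set0 \in powerset S.
Proof. by rewrite powersetE sub0set. Qed.
Fact simplex_onS (s t : {set V}) :
  t \subset s -> s \in powerset S -> t \in powerset S.
Proof. by rewrite !powersetE; apply: subset_trans. Qed.
Definition simplex_on : complex V := Complex simplex_on0 simplex_onS.
End SimplexOn.

(* [K'] is obtained from [K] by replacing its vertex [v] with the block [eS]
   carrying [L]; the other vertices of the block are not vertices of [K]. *)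
Section Substitution.
Variables (V : finType) (K L K' : complex V) (eA eS eB : seq V) (v : V).
Let S := [set x in eS].
Hypothesis enumV : enum V = eA ++ eS ++ eB.
Hypothesis vS : v \in eS.
Hypothesis KS : forall s : {set V}, s \in faces K -> s :&: S \subset [set v].
Hypothesis LS : forall s : {set V}, s \in faces L -> s \subset S.
Hypothesis K'E : forall s : {set V}, (s \in faces K') =
  ((s :\: S) :|: (if s :&: S \in faces L then set0 else [set v]) \in faces K).

Notation pA := (mem eA).
Notation pS := (mem eS).
Notation Phi := (Phi pA pS v).
Implicit Types (a t n u w : seq V) (X Y Z F g : seq V -> 'F_2).

Definition block_split a t n := [/\ subseq a eA, subseq t eS & subseq n eB].

Let uniqV : [/\ uniq (eA ++ eS ++ eB), {in eA, forall x, x \notin eS},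
  {in eB, forall x, x \notin eS} & {in eB, forall x, x \notin eA}].
Proof.
have uV : uniq (eA ++ eS ++ eB) by rewrite -enumV enum_uniq.
move: (uV); rewrite {1}cat_uniq {1}has_cat negb_or => /and3P[_ /andP[AS AB]].
rewrite {1}cat_uniq => /and3P[_ SB _].
split; [exact: uV | | |] => x xe; apply/negP => xf.
- by case/hasP: AS; exists x.
- by case/hasP: SB; exists x.
- by case/hasP: AB; exists x.
Qed.

Let AS x : pA x -> ~~ pS x.
Proof. by have [_ h _ _] := uniqV; apply: h. Qed.

Lemma split_all a t n : block_split a t n ->
  [/\ all pA a, all pS t, all (predC pS) n & all (predC pA) n].
Proof.
have [_ _ BS BA] := uniqV; case=> /mem_subseq aA /mem_subseq tS /mem_subseq nB.
by split; apply/allP => x; [apply: aA|apply: tS|move/nB/BS|move/nB/BA].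
Qed.

Lemma split_sorted a t n : block_split a t n -> subseq (a ++ t ++ n) (enum V).
Proof. by case=> aA tS nB; rewrite enumV !cat_subseq. Qed.

Lemma split_drop a t n : block_split a t n -> block_split a [::] n.
Proof. by case=> aA tS nB; split=> //; apply: sub0seq. Qed.

Lemma split_v a t n : block_split a t n -> block_split a [:: v] n.
Proof. by case=> aA tS nB; split=> //; rewrite sub1seq. Qed.

Lemma split_sub a t t' n : block_split a t n -> subseq t' t -> block_split a t' n.
Proof. by case=> aA tS nB t't; split=> //; apply: subseq_trans tS. Qed.

Definition inL t := [set x in t] \in faces L.

Let slist a t n : block_split a t n ->
  ([set x in a ++ t ++ n] :\: S = [set x in a ++ n]) /\
  ([set x in a ++ t ++ n] :&: S = [set x in t]).
Proof.
case/split_all => /allP aA /allP tS /allP nS _.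
split; apply/setP => x; rewrite !inE !mem_cat.
  case xS : (x \in eS) => /=.
    apply/esym/negbTE; rewrite negb_or; apply/andP; split; apply/negP => h.
      by have /AS/negP[] := aA _ h.
    by have /negP[] := nS _ h.
  by have -> : (x \in t) = false by apply: contraFF xS; apply: tS.
case xS : (x \in eS); rewrite ?andbT ?andbF.
  case: (x \in t) => //; rewrite ?orbT //.
  apply/negbTE; rewrite negb_or; apply/andP; split; apply/negP => h.
    by have /AS/negP[] := aA _ h.
  by have /negP[] := nS _ h.
by apply/esym; apply: contraFF xS; apply: tS.
Qed.

Lemma klistK'_split a t n : block_split a t n ->
  klist K' (a ++ t ++ n) = if inL t then klist K (a ++ n) else klist K (a ++ v :: n).
Proof.
move=> s; have [sD sI] := slist s.
rewrite /klist (split_sorted s) /= K'E sD sI -/(inL t).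
case: ifP => _.
  by rewrite setU0 (split_sorted (split_drop s)).
rewrite (split_sorted (split_v s)) /=.
suff -> : [set x in a ++ n] :|: [set v] = [set x in a ++ v :: n] by [].
by apply/setP => x; rewrite !inE !mem_cat inE -orbA [(x \in n) || _]orbC.
Qed.

Lemma klistK'P u : klist K' u -> exists a t n, [/\ block_split a t n,
  u = a ++ t ++ n, klist K (a ++ n) & inL t \/ klist K (a ++ v :: n)].
Proof.
move=> uK; have /andP[uV _] := uK; move: uV; rewrite enumV.
move=> /subseq_catP[a [u' [e aA /subseq_catP[t [n [e' tS nB]]]]]].
have s : block_split a t n by [].
exists a, t, n; rewrite e e'; split=> //.
  move: uK; rewrite e e' klistK'_split //; case: ifP => // _.
  by apply: klist_sub; rewrite subseq_cat2l subseq_cons.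
by move: uK; rewrite e e' klistK'_split //; case: ifP => //; [left|right].
Qed.

Lemma klistKP u : klist K u -> exists a n, block_split a [::] n /\
  (u = a ++ n \/ u = a ++ v :: n).
Proof.
case/andP=> uV uK; move: uV; rewrite enumV.
move=> /subseq_catP[a [u' [e aA /subseq_catP[t [n [e' tS nB]]]]]].
have s : block_split a t n by [].
exists a, n; split; first exact: split_drop s.
have := KS uK; rewrite e e' (slist s).2 => /subsetP tv.
have ut : uniq t.
  apply: subseq_uniq tS _; have [] := uniqV.
  by rewrite !cat_uniq => /and3P[_ _ /and3P[]].
have {}tv x : x \in t -> x = v by move=> xt; apply/eqP; rewrite -in_set1 tv ?inE.
case: t ut tv {s tS e e'} => [|x [|y t]] /= ut tv; [by left|right|].
  by rewrite (tv x) ?mem_head.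
by move: ut; rewrite (tv x) ?mem_head // (tv y) ?inE ?eqxx ?orbT.
Qed.

Lemma klist_in_block (M : complex V) t :
  (forall s : {set V}, s \in faces M -> s \subset S) -> klist M t -> subseq t eS.
Proof.
move=> MS /andP[tV tM]; have /subsetP tS := MS _ tM; move: tV; rewrite enumV.
move=> /subseq_catP[a [u' [e aA /subseq_catP[t' [n [e' t'S nB]]]]]].
have s : block_split a t' n by [].
have [/allP aA' _ /allP nS _] := split_all s.
have a0 : a = [::].
  case: (a) e aA' => // x a' e aA'; have := tS x.
  rewrite e !inE eqxx => /(_ isT) xS; by have /AS/negP[] := aA' x (mem_head _ _).
have n0 : n = [::].
  case: (n) e' nS => // x n' e' nS; have := tS x.
  rewrite e e' !inE !mem_cat mem_head !orbT => /(_ isT) xS.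
  by have /negP[] := nS x (mem_head _ _).
by rewrite e e' a0 n0 cats0.
Qed.

Lemma klistL_split a t n : block_split a t n -> inL t -> klist L t.
Proof.
case=> aA tS nB tL; rewrite /klist -/(inL t) tL andbT; apply: subseq_trans tS _.
by rewrite enumV; apply: subseq_trans (prefix_subseq _ _) (suffix_subseq _ _).
Qed.

Lemma Phi_split F g a t n : block_split a t n ->
  Phi F g (a ++ t ++ n) = F t * g (a ++ n) + ld F t * g (a ++ v :: n).
Proof. case/split_all => h1 h2 h3 h4; exact: (PhiE v AS F g h1 h2 h3 h4). Qed.

Lemma ld_Phi_split F g a t n : block_split a t n ->
  ld (Phi F g) (a ++ t ++ n) = Phi F (ld g) (a ++ t ++ n).
Proof. case/split_all => h1 h2 h3 h4; exact: (ld_Phi F2_two v AS F g h1 h2 h3 h4). Qed.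

Lemma PhiDl F F' g u : Phi (fun w => F w + F' w) g u = Phi F g u + Phi F' g u.
Proof. by rewrite /Phi /tns ldD; ring. Qed.

Lemma PhiDr F g g' u : Phi F (fun w => g w + g' w) u = Phi F g u + Phi F g' u.
Proof. by rewrite /Phi /tns; ring. Qed.

Notation cocK g := (mk K g \in cocycles K).
Notation cocL F := (mk L F \in cocycles L).

Lemma ld_cocL F a t n : cocL F -> block_split a t n -> inL t -> ld F t = 0.
Proof. by move=> /cocycles_mk F0 s tL; apply/F0/(klistL_split s). Qed.

(** If [t] lies in [L], then [a ++ v :: n] may fail to be a face of [K] and the value of [g] there
    is arbitrary; it is multiplied by [ld F t], which is zero. *)
Lemma Phi_ext F g g' : cocL F -> mk K g = mk K g' ->
  mk K' (Phi F g) = mk K' (Phi F g').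
Proof.
move=> FZ gg'; apply: mk_ext => _ /klistK'P[a [t [n [s -> anK c]]]].
rewrite !Phi_split // (mk_inj gg' anK); case: c => [tL | avnK].
  by rewrite (ld_cocL FZ s tL) !mul0r.
by rewrite (mk_inj gg' avnK).
Qed.

Lemma Phi_cocycle F g : cocL F -> cocK g -> mk K' (Phi F g) \in cocycles K'.
Proof.
move=> FZ /cocycles_mk g0; apply/cocycles_mk => _ /klistK'P[a [t [n [s -> anK c]]]].
rewrite ld_Phi_split // Phi_split // g0 // mulr0 add0r; case: c => [tL | avnK].
  by rewrite (ld_cocL FZ s tL) !mul0r.
by rewrite g0 ?mulr0.
Qed.

Lemma Phi_cobound_r F h : cocL F -> mk K' (Phi F (ld h)) \in coboundaries K'.
Proof.
move=> FZ; apply/coboundariesP; exists (Phi F h).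
by apply: mk_ext => _ /klistK'P[a [t [n [s -> _ _]]]]; rewrite ld_Phi_split.
Qed.

Let ld_tns_split (P Q : seq V -> 'F_2) a t n : block_split a t n ->
  ld (tns pS P Q) (a ++ t ++ n) = ld P t * Q (a ++ n) + P t * ld Q (a ++ n).
Proof.
move=> s; have [aA tS nS nA] := split_all s.
by rewrite (ld_tns F2_two) (fS_cat3 AS) // (fN_cat3 AS).
Qed.

Lemma Phi_cobound_l Y g : cocK g -> mk K' (Phi (ld Y) g) \in coboundaries K'.
Proof.
move=> /cocycles_mk g0; apply/coboundariesP; exists (tns pS Y g).
apply: mk_ext => _ /klistK'P[a [t [n [s -> anK _]]]].
rewrite Phi_split // ld_tns_split // g0 // mulr0 (ldK _ _ F2_addrr).
by rewrite mul0r.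
Qed.

(** Makes the class of [Phi F g] independent of how [F] is extended from [L] to the simplex. By
    [ld_ins] the coboundary of Z(t) g(a v n) is dZ(t) g(a v n) + Z(t) g(a n) + Z(t) dg(a v n), and
    the last term vanishes on [K']. *)
Lemma Phi_relative Z g : cocK g -> (forall t, klist L t -> Z t = 0) ->
  mk K' (Phi Z g) \in coboundaries K'.
Proof.
move=> /cocycles_mk g0 Z0; apply/coboundariesP.
exists (tns pS Z (fun w => g (ins pA v w))).
apply: mk_ext => _ /klistK'P[a [t [n [s -> anK c]]]].
have [aA tS nS nA] := split_all s.
rewrite Phi_split // ld_tns_split // (ld_ins _ _ F2_addrr) // ins_cat //.
case: c => [tL | avnK].
  by rewrite (Z0 t) ?mul0r ?add0r ?addr0 // (klistL_split s).
by rewrite g0 // addr0 addrC.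
Qed.

Definition subst_class (x : coh_space K) (y : coh_space L) : coh_space K' :=
  coh_class (mk K' (Phi (rd (vsval y)) (rd (vsval x)))).

Lemma subst_classE F g : cocL F -> cocK g ->
  subst_class (coh_class (mk K g)) (coh_class (mk L F)) =
  coh_class (mk K' (Phi F g)).
Proof.
move=> FZ gZ; rewrite /subst_class; set x := coh_class (mk K g); set y := coh_class (mk L F).
set g' := rd (vsval x); set F' := rd (vsval y).
have xZ : cocK g' by rewrite mk_rd vsval_cocycle.
have yZ : cocL F' by rewrite mk_rd vsval_cocycle.
have /coboundariesP[h eh] : mk K g' + mk K g \in coboundaries K.
  by apply/coh_class_eqP; rewrite // /g' mk_rd coh_class_val.
have /coboundariesP[Y eY] : mk L F' + mk L F \in coboundaries L.
  by apply/coh_class_eqP; rewrite // /F' mk_rd coh_class_val.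
apply/coh_class_eqP; try exact: Phi_cocycle.
have -> : mk K' (Phi F' g') + mk K' (Phi F g) =
    mk K' (Phi F' (fun w => g' w + g w)) + mk K' (Phi (fun w => F' w + F w) g).
  rewrite -!mkD; apply: mk_ext => u _; rewrite PhiDl PhiDr.
  move: (Phi F' g' u) (Phi F' g u) (Phi F g u) => p q r.
  by rewrite addrA -[p + q + q]addrA F2_addrr addr0.
rewrite rpredD //.
  by rewrite (Phi_ext (g' := ld h) yZ) ?Phi_cobound_r // mkD.
(* [F' + F] equals [ld Y] on [L] only; [Z] is the discrepancy elsewhere, left to [Phi_relative]. *)
pose Z w := F' w + F w + ld Y w.
have -> : mk K' (Phi (fun w => F' w + F w) g) =
    mk K' (Phi (ld Y) g) + mk K' (Phi Z g).
  rewrite -mkD; apply: mk_ext => u _; rewrite !PhiDl.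
  move: (Phi F' g u) (Phi F g u) (Phi (ld Y) g u) => p q r.
  by rewrite [RHS]addrC -addrA F2_addrr addr0.
rewrite rpredD ?Phi_cobound_l // Phi_relative // => t tL.
have e : mk L (fun w => F' w + F w) = mk L (ld Y) by rewrite mkD.
by rewrite /Z (mk_inj e tL) F2_addrr.
Qed.

Lemma subst_class_linearl y : linear (subst_class ^~ y).
Proof.
apply: linear_F2 => x x'; rewrite /subst_class -linearD -mkD.
congr coh_class; rewrite -(mk_ext (fun u _ => PhiDr _ _ _ u)).
apply: Phi_ext; first by rewrite mk_rd vsval_cocycle.
by apply: mk_ext => u _; rewrite rdD.
Qed.

Lemma subst_class_linearr x : linear (subst_class x).
Proof.
apply: linear_F2 => y y'; rewrite /subst_class -linearD -mkD.
congr coh_class; apply: mk_ext => u _; rewrite -PhiDl /Phi /tns.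
by congr (_ * _ + _ * _); rewrite ?rdD //; apply: ld_ext => w _; rewrite rdD.
Qed.

Definition subst_map (t : tens (redcoh K) (redcoh L)) : redcoh K' :=
  tens_lift subst_class t.

Lemma subst_map_linear : linear subst_map.
Proof. exact: tens_lift_linear. Qed.

Lemma subst_map_pure x y : subst_map (pure x y) = subst_class x y.
Proof.
apply: tens_lift_pure; [exact: subst_class_linearl|exact: subst_class_linearr].
Qed.

(** In the first term of [Phi] the block has [Q] vertices and the rest [P]; in the second the block
    has [Q + 1] and [v] is dropped from the [P] vertices of [a v n]. Both faces have [P + Q]
    vertices, hence degree (P - 1) + (Q - 1) + 1. *)
Lemma Phi_supp P Q F g : supp Q F -> supp P g -> forall u, klist K' u ->
  tr (P + Q) (Phi F g) u = Phi F g u.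
Proof.
move=> FQ gP _ /klistK'P[a [t [n [s -> _ _]]]].
rewrite /tr; case: eqP => // e; rewrite Phi_split //.
have dF : size t != Q.+1 -> ld F t = 0.
  move=> tQ; have -> : ld F t = ld (tr Q F) t.
    by apply: ld_ext => w _; rewrite tr_id.
  by rewrite ld_tr /tr (negPf tQ).
have [tQ|tQ] := eqVneq (size t) Q.
  rewrite (gP (a ++ n)) ?dF ?mulr0 ?mul0r ?addr0 //; first by rewrite tQ; lia.
  by apply/eqP => e'; apply: e; rewrite !size_cat in e' *; lia.
rewrite FQ // mul0r add0r.
have [tQ'|tQ'] := eqVneq (size t) Q.+1; last by rewrite dF // mul0r.
rewrite gP ?mulr0 //.
by apply/eqP => e'; apply: e; rewrite !size_cat /= in e' *; lia.
Qed.

Lemma subst_map_homog (n : int) (t : susp (tens (redcoh K) (redcoh L))) :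
  homog n t -> homog n (subst_map t).
Proof.
move=> [s -> sh]; rewrite (sum_linear subst_map_linear) big_seq.
apply: homog_sum => [|p ps]; first exact: graded_redcoh.
have [a [b [ab h1 h2]]] := sh _ ps; rewrite subst_map_pure.
have zero : homog (s := redcoh K') n 0 by apply: homog0 (graded_redcoh K') _.
case: (homog_clsP h1) => [->|[P [g [eP gP gZ ->]]]].
  by rewrite (linear_at0 (subst_class_linearl _)).
case: (homog_clsP h2) => [->|[Q [F [eQ FQ FZ ->]]]].
  by rewrite (linear_at0 (subst_class_linearr _)).
rewrite subst_classE // -(mk_ext (Phi_supp FQ gP)).
have -> : n = (P + Q)%N%:Z - 1 by rewrite PoszD; lia.
apply: homog_cls; first by move=> w; apply: tr_size.
by apply: cocycle_tr; apply: Phi_cocycle.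
Qed.

Lemma Phi_0l F g u : (forall w, F w = 0) -> Phi F g u = 0.
Proof.
move=> F0; rewrite /Phi /tns F0 (ld_ext (Y := fun=> 0)) ?ld0 ?mul0r ?add0r //.
Qed.

Lemma Phi_0r F g u : (forall w, g w = 0) -> Phi F g u = 0.
Proof. by move=> g0; rewrite /Phi /tns !g0 !mulr0 addr0. Qed.

Lemma subst_class_Sq k P Q F g : supp Q F -> supp P g -> cocL F -> cocK g ->
  \sum_(i < k.+1) subst_class (Sq (s := redcoh K) i (coh_class (mk K g)))
                 (Sq (s := redcoh L) (k - i) (coh_class (mk L F))) =
  Sq (s := redcoh K') k (subst_class (coh_class (mk K g)) (coh_class (mk L F))).
Proof.
move=> FQ gP FZ gZ; rewrite subst_classE //.
have sqZ (M : complex V) R i X : mk M X \in cocycles M ->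
    mk M (sq R i X) \in cocycles M.
  by move=> XZ; rewrite /sq; case: ifP => _; [apply: cupn_closed | rewrite mk0 mem0v].
rewrite (eq_bigr (fun i : 'I_k.+1 =>
  coh_class (mk K' (Phi (sq Q (k - i) F) (sq P i g))))); last first.
  move=> i _; rewrite (Sq_mk i gP gZ) (Sq_mk (k - i) FQ FZ).
  by apply: subst_classE; apply: sqZ.
rewrite -(linear_sum (@coh_class V K')) -(mk_ext (Phi_supp FQ gP)).
have XS : supp (P + Q) (tr (P + Q) (Phi F g)) by move=> w; apply: tr_size.
rewrite (Sq_mk k XS); last first.
  by apply: cocycle_tr; apply: Phi_cocycle.
(* For [k > P + Q] every index has [i > P] or [k - i > Q], so each summand vanishes. *)
rewrite mk_sum [in RHS]/sq; case: (leqP k (P + Q)) => kPQ; last first.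
  congr coh_class; apply: mk_ext => u _; rewrite big1 // => i _.
  rewrite /sq; case: (leqP i P) => iP; last by apply: Phi_0r.
  by case: (leqP (k - i) Q) => kiQ; [lia | apply: Phi_0l].
have [W eW] := cupn_Phi v AS (P + Q - k) F g.
pose A u j l := Phi (cupn j F F) (cupn l g g) u.
(* The alternative offered by [klistK'P] for each face is the one demanded by [cupn_Phi]. *)
have -> : mk K' (cupn (P + Q - k) (tr (P + Q) (Phi F g)) (tr (P + Q) (Phi F g))) =
   mk K' (fun u => \sum_(j < (P + Q - k).+1) A u j (P + Q - k - j)%N) + mk K' (ld W).
  rewrite -mkD; apply: mk_ext => u uK.
  have e w : subseq w u -> tr (P + Q) (Phi F g) w = Phi F g w.
    by move=> wu; apply: (Phi_supp FQ gP); apply: klist_sub uK.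
  rewrite (cupn_ext _ e e); move: uK => /klistK'P[a [t [n [s -> anK c]]]].
  have [aA tS nS nA] := split_all s.
  apply: eW => // [w wan|]; first by move/cocycles_mk: gZ; apply; apply: klist_sub anK.
  case: c => [tL|avnK]; [left|right] => w ws.
    by move/cocycles_mk: FZ; apply; apply: klist_sub ws (klistL_split s tL).
  by move/cocycles_mk: gZ; apply; apply: klist_sub avnK.
rewrite linearD /= (coh_class0 (coboundaries_mk _ _)) addr0; congr coh_class.
apply: mk_ext => u _; rewrite -sum_bidegree //; last first.
  move=> j l /orP[jQ|lP]; [apply: Phi_0l => w | apply: Phi_0r => w].
    exact: cupn_high FQ jQ.
  exact: cupn_high gP lP.
rewrite [RHS]big_mkcond; apply: eq_bigr => i _; rewrite /sq /A.
case: (leqP i P) => iP /=; last by apply: Phi_0r.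
by case: (leqP (k - i) Q) => // kiQ; apply: Phi_0l.
Qed.

Lemma subst_map_Sq k (n : int) (t : susp (tens (redcoh K) (redcoh L))) :
  homog n t -> subst_map (Sq k t) = Sq k (subst_map t).
Proof.
have gK := graded_redcoh K; have gL := graded_redcoh L.
have gK' := graded_redcoh K'.
have SK := Sq_linear k gK'.
move=> [s -> sh].
rewrite -[Sq k _]/(Sq (s := tens (redcoh K) (redcoh L)) k (\sum_(p <- s) _)).
rewrite (sum_linear (Sq_linear k (graded_tens gK gL))).
rewrite !(sum_linear subst_map_linear) (sum_linear SK) big_seq [RHS]big_seq.
apply: eq_bigr => p ps; have [a [b [ab h1 h2]]] := sh _ ps.
rewrite (Sq_pure k _ _ gK gL) (sum_linear subst_map_linear) subst_map_pure.
rewrite (eq_bigr (fun i : 'I_k.+1 => subst_class (Sq i p.1) (Sq (k - i) p.2)));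
  last by move=> i _; apply: subst_map_pure.
case: (homog_clsP h1) => [->|[P [g [eP gP gZ ->]]]].
  rewrite (linear_at0 (subst_class_linearl _)) (linear_at0 SK) big1 // => i _.
  by rewrite (linear_at0 (Sq_linear i gK)) (linear_at0 (subst_class_linearl _)).
case: (homog_clsP h2) => [->|[Q [F [eQ FQ FZ ->]]]].
  rewrite (linear_at0 (subst_class_linearr _)) (linear_at0 SK) big1 // => i _.
  rewrite (linear_at0 (Sq_linear (k - i) gL)).
  exact: (linear_at0 (subst_class_linearr _)).
exact: (subst_class_Sq k FQ gP FZ gZ).
Qed.

(** * Bijectivity of the substitution map *)

Notation D := (simplex_on S).

Let LD s : s \in faces L -> s \in faces D.
Proof. by move=> /LS sS; rewrite powersetE. Qed.

Let vD s : s \in faces D -> v |: s \in faces D.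
Proof. by rewrite !powersetE subUset sub1set inE vS. Qed.

Let klistDP t : klist D t -> subseq t eS.
Proof. by apply: klist_in_block => s; rewrite powersetE. Qed.

Let klistD a t n : block_split a t n -> klist D t.
Proof.
move=> [_ tS _]; rewrite /klist powersetE; apply/andP; split.
  apply: subseq_trans tS _; rewrite enumV.
  by apply: subseq_trans (prefix_subseq _ _) (suffix_subseq _ _).
by apply/subsetP => x; rewrite !inE; apply: mem_subseq.
Qed.

Let split_cons a t n t' : block_split a t n -> subseq t' eS -> block_split a t' n.
Proof. by case=> aA _ nB tS. Qed.

(** [X] as a function of the block part, with the part [w] outside the block held fixed. It lives on
    the full simplex because all block parts occur when [a v n] is a face of [K]. *)
Definition block_slice X w : cochain D :=
  mk D (fun t => X (filter pA w ++ t ++ filter (predC pA) w)).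

Let filter_split a t n : block_split a t n ->
  filter pA (a ++ n) = a /\ filter (predC pA) (a ++ n) = n.
Proof.
case/split_all => aA _ _ nA; rewrite !filter_cat (all_filterP aA) (all_filterP nA).
by rewrite (filter_none nA) (filterC_none aA) cats0.
Qed.

Lemma block_sliceE X a t n : block_split a t n ->
  block_slice X (a ++ n) = mk D (fun t => X (a ++ t ++ n)).
Proof. by case/filter_split => ea en; rewrite /block_slice ea en. Qed.

Lemma rd_slice X a t n : block_split a t n ->
  rd (block_slice X (a ++ n)) t = X (a ++ t ++ n).
Proof. by move=> s; rewrite (block_sliceE _ s) rd_mk // (klistD s). Qed.

Lemma ld_block X a t n : all pA a -> all (predC pA) n ->
  ld X (a ++ t ++ n) =
  ld (fun w => X (filter pA w ++ t ++ filter (predC pA) w)) (a ++ n) +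
  ld (fun t => X (a ++ t ++ n)) t.
Proof.
move=> aA nA; elim: a aA X => [_|x a IH /= /andP[xA aA]] X /=; last first.
  rewrite IH // !filter_cat (all_filterP aA) (all_filterP nA).
  rewrite (filter_none nA) (filterC_none aA) cats0 addrA.
  congr (_ + _ + _); apply: ld_ext => w _; rewrite /sh /= xA //.
rewrite [in RHS](ld_ext (u := n) (Y := fun w => X (t ++ w))); last first.
  move=> w /mem_subseq wn.
  have wA : all (predC pA) w by apply/allP => z zw; exact: (allP nA) _ (wn _ zw).
  by rewrite (filter_none wA) (all_filterP wA).
elim: t X => [|x t IH] X /=; first by rewrite addr0; apply: ld_ext.
by rewrite IH addrCA.
Qed.

Lemma ld_rd (M : complex V) (Z : seq V -> cochain M) t u :
  ld (fun w => rd (Z w) t) u = rd (ld Z u) t.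
Proof.
apply: (ld_morph (f := fun z : cochain M => rd z t)) => [|x y]; last exact: rdD.
by rewrite -(scale0r (0 : cochain M)) rdZ mul0r.
Qed.

(** Deletions outside the block and inside it are the two differentials of a double complex, and
    [ld] on [K'] is their sum. *)
Lemma ld_slice X a n : block_split a [::] n ->
  ld (block_slice X) (a ++ n) =
  cobound (block_slice X (a ++ n)) + block_slice (ld X) (a ++ n).
Proof.
move=> s; rewrite -[LHS]addr0 -(addrr_F2 (cobound (block_slice X (a ++ n)))).
rewrite addrCA; congr (_ + _); rewrite -[LHS]mk_rd (block_sliceE (ld X) s).
apply: mk_ext => t tD; have st := split_cons s (klistDP tD).
have [aA tS nS nA] := split_all st.
rewrite rdD rd_cobound // (ld_block _ _ aA nA); congr (_ + _).
  by rewrite -ld_rd; apply: ld_ext => w _; rewrite rd_mk.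
apply: ld_ext => w wt; apply: rd_slice; exact: split_sub st wt.
Qed.

Section Inverse.
Variables (kap : cochain D -> coh_space L) (H : cochain D -> cochain D).
Hypothesis kap_linear : linear kap.
Hypothesis H_linear : linear H.
Hypothesis kap_cobound : forall Z : cochain D, kap (cobound Z) = cls_part (restr L Z).
Hypothesis kap_extend : forall y : coh_space L, kap (extend D (vsval y)) = 0.
Hypothesis H_homotopy : forall Z : cochain D, cobound (H Z) + H (cobound Z) =
  Z + (extend D (vsval (cls_part (restr L Z))) +
       cobound (extend D (vsval (kap Z)))).
Hypothesis H_restr : forall Z : cochain D, restr L Z = 0 -> restr L (H Z) = 0.

(* A cochain map from the cochains of [K'] to those of [K] with values in the
   cohomology of [L]; it is inverse to [Phi] up to homotopy. *)
Definition retract X w : coh_space L :=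
  if v \in w then kap (block_slice X (filter (predC pS) w))
  else cls_part (restr L (block_slice X w)).

Let vNA : v \notin eA.
Proof. by apply/negP => /AS; rewrite /= vS. Qed.

Let vNB : v \notin eB.
Proof. by have [_ _ BS _] := uniqV; apply/negP => /BS; rewrite vS. Qed.

Lemma retract_drop X a n : block_split a [::] n ->
  retract X (a ++ n) = cls_part (restr L (block_slice X (a ++ n))).
Proof.
case=> /mem_subseq aA _ /mem_subseq nB; rewrite /retract mem_cat.
by rewrite (contraNF (aA v) vNA) (contraNF (nB v) vNB).
Qed.

Lemma retract_v X a n : block_split a [::] n ->
  retract X (a ++ v :: n) = kap (block_slice X (a ++ n)).
Proof.
move=> s; rewrite /retract mem_cat mem_head orbT; congr (kap (block_slice _ _)).
have [aA _ nS _] := split_all s.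
have aN : all (predC pS) a by apply: sub_all aA.
by rewrite filter_cat (all_filterP aN) /= vS (all_filterP nS).
Qed.

Let split_sublist a n w : block_split a [::] n -> subseq w (a ++ n) ->
  exists a' n', w = a' ++ n' /\ block_split a' [::] n'.
Proof.
move=> [aA _ nB] /subseq_catP[a' [n' [-> a'a n'n]]]; exists a', n'.
split=> //; split; [exact: subseq_trans aA | exact: sub0seq |].
exact: subseq_trans nB.
Qed.

Lemma retractD X Y w : retract (fun u => X u + Y u) w = retract X w + retract Y w.
Proof.
rewrite /retract; case: ifP => _.
  by rewrite -(linear_atD _ _ kap_linear) /block_slice mkD.
rewrite -(linear_atD _ _ (@cls_part_linear _ _)) -(linear_atD _ _ (@restr_linear _ _ _)).
by rewrite /block_slice mkD.
Qed.

(** On [a ++ n] the inner coboundary of [ld_slice] is killed by [cls_part]. On [a ++ v :: n] it is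
    turned by [kap_cobound] into the value of [retract X] at [a ++ n], which is the term of [ld]
    that deletes [v]. *)
Lemma ld_retract X w : klist K w -> ld (retract X) w = retract (ld X) w.
Proof.
have drop a n : block_split a [::] n ->
    ld (retract X) (a ++ n) = retract (ld X) (a ++ n).
  move=> s; rewrite retract_drop //.
  rewrite (ld_ext (Y := fun w => cls_part (restr L (block_slice X w)))); last first.
    by move=> w' /(split_sublist s)[a' [n' [-> s']]]; apply: retract_drop.
  rewrite (ld_morph (f := fun Z : cochain D => cls_part (restr L Z))); first last.
  - by move=> x y; rewrite !(linear_atD _ _ (@restr_linear _ _ _),
      linear_atD _ _ (@cls_part_linear _ _)).
  - by rewrite (linear_at0 (@restr_linear _ _ _)) (linear_at0 (@cls_part_linear _ _)).
  rewrite ld_slice // (linear_atD _ _ (@restr_linear _ _ _)).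
  rewrite (linear_atD _ _ (@cls_part_linear _ _)) restr_cobound //.
  by rewrite cls_part_cobound add0r.
case/klistKP=> a [n [s [->|->]]]; first exact: drop.
have [aA _ nS nA] := split_all s; rewrite retract_v //.
have add2 (m : coh_space L) : m + m = 0 by apply: addrr_F2.
have := ld_ins v (retract X) add2 aA nA.
rewrite (ld_ext (Y := fun w => kap (block_slice X w))); last first.
  move=> w' /(split_sublist s)[a' [n' [-> s']]].
  have [aA' _ _ nA'] := split_all s'.
  by rewrite ins_cat // retract_v.
rewrite (ld_morph (f := kap)) ?(linear_at0 kap_linear) //; last first.
  by move=> x y; apply: linear_atD.
rewrite ld_slice // (linear_atD _ _ kap_linear) kap_cobound -retract_drop //.
by move/addrI.
Qed.

(** If only [a ++ n] is known to be a face of [K], then just the blocks in [L] give faces of [K'],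
    and only those enter through [restr]. If [a ++ v :: n] is a face, all blocks do. *)
Lemma retract_ext X Y : mk K' X = mk K' Y ->
  forall w, klist K w -> retract X w = retract Y w.
Proof.
move=> XY w wK; case/klistKP: (wK) => a [n [s [e|e]]]; rewrite e in wK *.
  rewrite !retract_drop //; congr cls_part; apply: mk_ext => t tL.
  have st := split_cons s (klist_in_block LS tL).
  rewrite !(rd_slice _ st); apply: (mk_inj XY).
  by rewrite klistK'_split // /inL; have /andP[_ ->] := tL.
rewrite !retract_v // !(block_sliceE _ s); congr kap; apply: mk_ext => t tD.
have st := split_cons s (klistDP tD); apply: (mk_inj XY).
rewrite klistK'_split //; case: ifP => // _.
by apply: klist_sub wK; rewrite subseq_cat2l subseq_cons.
Qed.

(** The slice of [Phi] is g(a n) times the extended representative of [y] plus g(a v n) times its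
    coboundary. The map [cls_part] detects the first summand and [kap] the second. *)
Lemma retract_Phi (y : coh_space L) g w : klist K w ->
  retract (Phi (rd (vsval y)) g) w = g w *: y.
Proof.
move=> /klistKP[a [n [s e]]].
have slE : block_slice (Phi (rd (vsval y)) g) (a ++ n) =
    g (a ++ n) *: extend D (vsval y) + g (a ++ v :: n) *: cobound (extend D (vsval y)).
  rewrite (block_sliceE _ s) -[RHS]mk_rd; apply: mk_ext => t tD.
  rewrite (Phi_split _ _ (split_cons s (klistDP tD))) rdD !rdZ /extend cobound_mk.
  by rewrite !rd_mk // ![g _ * _]mulrC.
have yc : cls_part (vsval y) = y by rewrite cls_part_cocycle ?vsval_cocycle // coh_class_val.
have restr_lin := @restr_linear V L D; have cls_lin := @cls_part_linear V L.
have sum_scale (c d : 'F_2) (f : cochain D -> coh_space L) z z' : linear f ->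
    f (c *: z + d *: z') = c *: f z + d *: f z'.
  by move=> fl; rewrite fl -[d *: z']addr0 fl (linear_at0 fl) addr0.
case: e => ->.
  rewrite retract_drop // slE.
  rewrite (sum_scale _ _ (fun z : cochain D => cls_part (restr L z))); last first.
    by move=> c x x'; rewrite restr_lin cls_lin.
  by rewrite restr_cobound // !extendK // cls_part_cobound yc scaler0 addr0.
rewrite retract_v // slE sum_scale // kap_extend kap_cobound extendK // yc.
by rewrite scaler0 add0r.
Qed.

Let F (y : coh_space L) := rd (vsval y).
Let b := vbasis {:coh_space L}.

Lemma retract_homotopy X u : (forall w, klist K' w -> ld X w = 0) ->
  klist K' u ->
  X u + \sum_(j < \dim {:coh_space L}) Phi (F b`_j) (fun w => coord b j (retract X w)) u =
  ld (fun w => rd (H (block_slice X (filter (predC pS) w))) (filter pS w)) u.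
Proof.
move=> X0 /klistK'P[a [t [n [s -> anK c]]]].
have s0 := split_drop s; have [aA tS nS nA] := split_all s.
have st t' : subseq t' t -> block_split a t' n by apply: split_sub.
rewrite (ld_block _ _ aA nA).
rewrite (ld_ext (u := a ++ n) (Y := fun w => rd (H (block_slice X w)) t)); last first.
  move=> w /(split_sublist s0)[a' [n' [-> s']]].
  have [-> ->] := filter_split s'.
  have [aA' _ nS' nA'] := split_all s'.
  by rewrite (fS_cat3 AS) // (fN_cat3 AS).
rewrite (ld_ext (u := t) (Y := rd (H (block_slice X (a ++ n))))); last first.
  by move=> t' /st s'; have [_ tS' _ _] := split_all s';
     rewrite (fS_cat3 AS) // (fN_cat3 AS).
rewrite (ld_morph (f := fun z : cochain D => rd (H z) t)); first last.
- by move=> x y; rewrite (linear_atD _ _ H_linear) rdD.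
- by rewrite (linear_at0 H_linear) -(scale0r (0 : cochain D)) rdZ mul0r.
rewrite -rd_cobound ?(klistD s) // ld_slice // (linear_atD _ _ H_linear) rdD.
(* If [a v n] is a face, the whole slice of [ld X] is zero. Otherwise it vanishes only on [L], and
   [H_restr] is what keeps its image under [H] zero there. *)
have -> : rd (H (block_slice (ld X) (a ++ n))) t = 0.
  case: c => [tL|avnK].
    have tLl := klistL_split s tL.
    have e : restr L (H (block_slice (ld X) (a ++ n))) = 0.
      apply: H_restr; rewrite -(mk0 L); apply: mk_ext => t' t'L.
      have s' := split_cons s (klist_in_block LS t'L).
      rewrite (rd_slice _ s') X0 // klistK'_split // /inL.
      by have /andP[_ ->] := t'L.
    by have := mk_inj (etrans e (esym (mk0 L))) tLl.
  have -> : block_slice (ld X) (a ++ n) = 0.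
    rewrite (block_sliceE _ s) -(mk0 D); apply: mk_ext => t' t'D.
    have s' := split_cons s (klistDP t'D).
    by rewrite X0 // klistK'_split //; case: ifP.
  by rewrite (linear_at0 H_linear) -(scale0r (0 : cochain D)) rdZ mul0r.
rewrite addr0 addrC -rdD H_homotopy !rdD (rd_slice _ s); congr (_ + _).
have coordE (f : coh_space L -> 'F_2) y : linear (f : coh_space L -> ('F_2)^o) ->
    f y = \sum_(j < \dim {:coh_space L}) coord b j y * f b`_j.
  move=> fl; rewrite {1}(coord_vbasis (memvf y)).
  rewrite (sum_linear fl); apply: eq_bigr => j _.
  by rewrite -[_ *: _]addr0 fl (linear_at0 fl) addr0.
(* By linearity in the class, the sum over [j] is evaluated at the two values of [retract], and
   these give the two correction terms of [H_homotopy]. *)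
rewrite (eq_bigr (fun j : 'I_(\dim {:coh_space L}) =>
   coord b j (retract X (a ++ n)) * F b`_j t +
   coord b j (retract X (a ++ v :: n)) * ld (F b`_j) t)); last first.
  by move=> j _; rewrite (Phi_split _ _ s); congr (_ + _); apply: mulrC.
rewrite big_split /= retract_drop // retract_v //; congr (_ + _).
  rewrite -(coordE (fun y => F y t)); last first.
    by move=> c' x y; rewrite /F linearP /= rdD rdZ.
  by rewrite rd_mk // (klistD s).
rewrite -(coordE (fun y => ld (F y) t)); last first.
  move=> c' x y; rewrite -[c' *: ld _ t]/(c' * ld (F x) t) -ldZ -ldD; apply: ld_ext => w _.
  by rewrite /F linearP /= rdD rdZ.
by rewrite rd_cobound ?(klistD s) //; apply: ld_ext => w wt;
   rewrite rd_mk // (klistD (st _ wt)).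
Qed.
(** The inverse uses the coordinates of [retract] in a basis of the cohomology of [L] and tensors
    each with its basis vector. [retract_Phi] settles one composite, [retract_homotopy] the
    other. *)
Lemma subst_map_bij : bijective subst_map.
Proof.
have retr0 X : (forall u, klist K' u -> X u = 0) ->
    forall w, klist K w -> retract X w = 0.
  move=> X0 w wK; rewrite (retract_ext (Y := fun u => X u + X u)) ?retractD ?addrr_F2 //.
  by apply: mk_ext => u uK; rewrite X0 // addr0.
have ldc (j : 'I_(\dim {:coh_space L})) X w : klist K w ->
    ld (fun w => coord b j (retract X w)) w = coord b j (retract (ld X) w).
  move=> wK; rewrite -ld_retract // -(ld_morph (f := coord b j)) ?linear0 //.
  exact: linearD.
have retrZ (j : 'I_(\dim {:coh_space L})) X : mk K' X \in cocycles K' ->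
    cocK (fun w => coord b j (retract X w)).
  move=> /cocycles_mk X0; apply/cocycles_mk => w wK.
  by rewrite ldc // retr0 ?linear0.
have /fin_all_exists[f fP] (j : 'I_(\dim {:coh_space L})) :
    exists f : redcoh K' -> redcoh K, linear f /\
    forall X, mk K' X \in cocycles K' -> f (coh_class (mk K' X)) =
      coh_class (mk K (fun w => coord b j (retract X w))).
  apply: (@coh_map V V K' K (fun X w => coord b j (retract X w))).
  - by move=> X Y w _; rewrite retractD linearD.
  - by move=> X Y XY; apply: mk_ext => w wK; rewrite (retract_ext XY).
  - by move=> X; apply: retrZ.
  - move=> X; apply/coboundariesP; exists (fun w => coord b j (retract X w)).
    by apply: mk_ext => w wK; rewrite ldc.
pose g (x : redcoh K') : tens (redcoh K) (redcoh L) :=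
  \sum_(j < \dim {:coh_space L}) pure (f j x : redcoh K) (b`_j : redcoh L).
have gl : linear g.
  apply: linear_F2 => x y; rewrite /g -big_split; apply: eq_bigr => j _.
  by rewrite (linear_atD _ _ (fP j).1) pureDl.
exists g.
  apply: tens_ext => [a x y|a x y|x y].
  - by rewrite subst_map_linear gl.
  - by [].
  rewrite subst_map_pure /g.
  have fE j : f j (subst_class x y) = coord b j y *: x.
    have xZ : cocK (rd (vsval x)) by rewrite mk_rd vsval_cocycle.
    have yZ : cocL (rd (vsval y)) by rewrite mk_rd vsval_cocycle.
    rewrite (fP j).2 ?Phi_cocycle // -[x in RHS]coh_class_val -linearZ.
    congr coh_class; rewrite -[RHS]mk_rd; apply: mk_ext => w wK.
    by rewrite retract_Phi // linearZ rdZ mulrC.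
  rewrite (eq_bigr (fun j => pure (x : redcoh K) (coord b j y *: b`_j : redcoh L))).
    by rewrite -pure_sumr -coord_vbasis ?memvf.
  by move=> j _; rewrite fE pureZl pureZr.
move=> x; pose X := rd (vsval x).
have XZ : mk K' X \in cocycles K' by rewrite mk_rd vsval_cocycle.
have xX : x = coh_class (mk K' X) by rewrite mk_rd coh_class_val.
have X0 : forall w, klist K' w -> ld X w = 0 by apply/cocycles_mk.
rewrite /g (sum_linear subst_map_linear).
have FZ j : cocL (F b`_j) by rewrite mk_rd vsval_cocycle.
rewrite (eq_bigr (fun j : 'I_(\dim {:coh_space L}) =>
  coh_class (mk K' (Phi (F b`_j) (fun w => coord b j (retract X w)))))).
  rewrite -linear_sum [in RHS]xX; apply/coh_class_eqP => //.
    by apply: rpred_sum => j _; apply: Phi_cocycle => //; apply: retrZ.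
  rewrite addrC; apply/coboundariesP.
  exists (fun w => rd (H (block_slice X (filter (predC pS) w))) (filter pS w)).
  rewrite mk_sum -mkD; apply: mk_ext => u uK.
  by rewrite -retract_homotopy.
move=> j _; rewrite subst_map_pure xX (fP j).2 //.
rewrite -[b`_j in LHS]coh_class_val -[vsval b`_j]mk_rd subst_classE //.
  exact: FZ.
exact: retrZ.
Qed.
End Inverse.

Theorem redcoh_subst :
  steenrod_iso (redcoh K') (susp (tens (redcoh K) (redcoh L))).
Proof.
have [kap [H [[kl Hl] k1 k2 H1 H2]]] := relative_contraction LD vD.
apply: steenrod_iso_sym.
apply: (@steenrod_isoI (susp (tens (redcoh K) (redcoh L))) (redcoh K') subst_map).
- exact/graded_susp/graded_tens/graded_redcoh/graded_redcoh.
- exact: graded_redcoh.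
- exact: redcoh_proj.
- exact: subst_map_linear.
- exact: subst_map_bij kl Hl k1 k2 H1 H2.
- exact: subst_map_homog.
- exact: subst_map_Sq.
Qed.

End Substitution.

(** * Replacing all vertices *)

Section Stages.
Variables (m : nat) (K : complex 'I_m) (l : 'I_m -> nat).
Variable L : forall i : 'I_m, complex 'I_(l i).+1.
Notation T_ := (fun i : 'I_m => 'I_(l i).+1).
Notation V := {i : 'I_m & 'I_(l i).+1}.
Implicit Types (s t : {set V}).

Let pt (i : 'I_m) : V := Tagged T_ (ord0 : 'I_(l i).+1).
Let blk (i : 'I_m) : seq V := [seq Tagged T_ x | x <- enum 'I_(l i).+1].

Let enumVE : enum {: V} = flatten [seq blk i | i <- enum 'I_m].
Proof.
rewrite enumT [in LHS]unlock /= /tag_enum -enumT; congr flatten.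
by apply: eq_map => i; rewrite /blk enumT.
Qed.

Let mem_blk (x : V) i : (x \in blk i) = (tag x == i).
Proof.
apply/mapP/eqP => [[y _ ->] // | e]; case: x e => j y /= e.
by subst j; exists y; rewrite ?mem_enum.
Qed.

Lemma slice_sub s t i : t \subset s -> slice t i \subset slice s i.
Proof. by move/subsetP => ts; apply/subsetP => x; rewrite !inE; apply: ts. Qed.

Lemma slice0 i : slice (set0 : {set V}) i = set0.
Proof. by apply/setP => x; rewrite !inE. Qed.

(** The smallest index set outside which every slice lies in its subcomplex, [L i] or the trivial
    one. As [K] is closed under subsets, it suffices to test this set instead of searching for a
    simplex of [K]. *)
Definition support_set r s : {set 'I_m} :=
  [set i : 'I_m | if (i < r)%N then slice s i \notin faces (L i)
                  else slice s i != set0].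

Definition stage_faces r : {set {set V}} :=
  [set s : {set V} | [forall i : 'I_m, (r <= i)%N ==> (slice s i \subset [set ord0])]
           && (support_set r s \in faces K)].

Fact stage0 r : set0 \in stage_faces r.
Proof.
rewrite inE; apply/andP; split.
  by apply/forallP => i; rewrite slice0 sub0set implybT.
suff -> : support_set r set0 = set0 by apply: complex0.
by apply/setP => i; rewrite !inE slice0 complex0 eqxx; case: ifP.
Qed.

Fact stageS r s t : t \subset s -> s \in stage_faces r -> t \in stage_faces r.
Proof.
move=> ts; rewrite !inE => /andP[/forallP s0 sK]; apply/andP; split.
  apply/forallP => i; apply/implyP => ri.
  by apply: subset_trans (implyP (s0 i) ri); apply: slice_sub.
apply: complexS sK; apply/subsetP => i; rewrite !inE; case: ifP => _.
  by apply: contra; apply: complexS; apply: slice_sub.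
by apply: contra => /eqP e; rewrite -subset0 -e slice_sub.
Qed.

(* [K(L_1, ..., L_r, {set0}, ..., {set0})] in the sense of the composition, each
   of the trivial complexes being placed on the simplex [ord0] of its block. *)
Definition stage r : complex V := Complex (stage0 r) (@stageS r).

(** [L i] is transported to its block of the common vertex set, because the substitution of one
    vertex has all complexes on the same vertices. *)
Definition block_complex_faces (i : 'I_m) : {set {set V}} :=
  [set s : {set V} | [forall x in s, tag x == i] && (slice s i \in faces (L i))].

Fact block_complex0 i : set0 \in block_complex_faces i.
Proof.
rewrite inE slice0 complex0 andbT.
by apply/forallP => x; rewrite inE.
Qed.

Fact block_complexS i s t : t \subset s ->
  s \in block_complex_faces i -> t \in block_complex_faces i.
Proof.
move=> ts; rewrite !inE => /andP[/forallP si sL]; apply/andP; split.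
  by apply/forallP => x; apply/implyP => /(subsetP ts)/(implyP (si x)).
by apply: complexS sL; apply: slice_sub.
Qed.

Definition block_complex i : complex V :=
  Complex (block_complex0 i) (@block_complexS i).

Lemma redcoh_block i : steenrod_iso (redcoh (L i)) (redcoh (block_complex i)).
Proof.
have slice_im (t : {set 'I_(l i).+1}) : slice (Tagged T_ @: t) i = t.
  apply/setP => x; rewrite inE; apply/imsetP/idP => [[y yt] /eqP|xt].
    by rewrite eq_Tagged /= => /eqP->.
  by exists x.
apply: (redcoh_relabel (e := Tagged T_ (i := i))).
- by move=> x y /eqP; rewrite eq_Tagged => /eqP.
- rewrite enumVE -/(blk i); have : i \in enum 'I_m by rewrite mem_enum.
  elim: (enum _) => //= j r IH; rewrite inE => /orP[/eqP->|/IH ir].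
    exact: prefix_subseq.
  exact: subseq_trans ir (suffix_subseq _ _).
move=> s; split=> [|[t tL ->]]; rewrite inE.
  case/andP=> /forallP si sL; exists (slice s i) => //.
  apply/setP => x; apply/idP/imsetP => [xs|[y yt ->]]; last by rewrite inE in yt.
  have /eqP e := implyP (si x) xs; case: x e xs => j y /= e; subst j => ys.
  by exists y; rewrite ?inE.
rewrite slice_im tL andbT; apply/forallP => x; apply/implyP.
by case/imsetP => y _ ->.
Qed.

Lemma redcoh_stage0 : steenrod_iso (redcoh K) (redcoh (stage 0)).
Proof.
apply: (redcoh_relabel (e := pt)).
- by move=> i j /(congr1 tag).
- rewrite enumVE; elim: (enum 'I_m) => //= i r IH.
  rewrite -cat1s; apply: cat_subseq IH; rewrite sub1seq mem_blk //.
have slice_pt (t : {set 'I_m}) i :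
    slice (pt @: t) i = if i \in t then [set ord0] else set0.
  apply/setP => x; rewrite inE; apply/imsetP/idP => [[j jt e]|].
    have ij : i = j by apply: (congr1 tag e).
    subst j; rewrite jt inE; move/eqP: e; rewrite eq_Tagged //.
  by case: ifP => it; rewrite inE // => /eqP->; exists i.
move=> s; split=> [|[t tK ->]]; rewrite inE.
  case/andP=> /forallP s0 sK; exists (support_set 0 s) => //.
  apply/setP => -[i x]; have : x \in slice s i = (Tagged T_ x \in s) by rewrite inE.
  have : x \in slice (pt @: support_set 0 s) i = (Tagged T_ x \in pt @: support_set 0 s).
    by rewrite inE.
  rewrite slice_pt [i \in _]inE /= => <- <-; have := implyP (s0 i) (leq0n _).
  rewrite subset1 => /orP[/eqP->|/eqP->]; last by rewrite eqxx.
  by case: eqP => // /setP/(_ ord0); rewrite !inE eqxx.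
apply/andP; split.
  by apply/forallP => i; rewrite slice_pt; case: ifP; rewrite ?sub0set ?subxx.
suff -> : support_set 0 (pt @: t) = t by [].
apply/setP => i; rewrite inE /= slice_pt; case: ifP => _; rewrite ?eqxx //.
by apply/eqP => /setP/(_ ord0); rewrite !inE eqxx.
Qed.

Lemma redcoh_stage_last :
  steenrod_iso (redcoh (composition K L)) (redcoh (stage m)).
Proof.
apply: (redcoh_relabel (e := id)) => //; first by rewrite map_id.
move=> s; have -> : (exists2 t, t \in faces (composition K L) & s = id @: t) <->
    s \in faces (composition K L).
  split=> [[t tK ->]|sK]; first by rewrite imset_id.
  by exists s; rewrite ?imset_id.
have supE : support_set m s = [set i | slice s i \notin faces (L i)].
  by apply/setP => i; rewrite !inE ltn_ord.
rewrite inE supE; split=> [/andP[_ sK] | /bigcupP[r rK]].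
  apply/bigcupP; exists [set i | slice s i \notin faces (L i)] => //.
  rewrite inE; apply/forallP => i; rewrite inE.
  by case: ifPn; rewrite ?inE // negbK.
rewrite inE => /forallP sr; apply/andP; split.
  by apply/forallP => i; rewrite leqNgt ltn_ord.
apply: complexS rK; apply/subsetP => i; rewrite inE; apply: contraR => ir.
by have := sr i; rewrite (negPf ir).
Qed.

Lemma redcoh_stageS (i : 'I_m) : steenrod_iso (redcoh (stage i.+1))
  (susp (tens (redcoh (stage i)) (redcoh (block_complex i)))).
Proof.
have blkS (x : V) : (x \in [set x in blk i]) = (tag x == i).
  by rewrite inE mem_blk.
apply: (redcoh_subst (eA := flatten [seq blk j | j <- take i (enum 'I_m)])
  (eS := blk i) (eB := flatten [seq blk j | j <- drop i.+1 (enum 'I_m)])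
  (v := pt i)).
- rewrite enumVE -{1}(cat_take_drop i (enum 'I_m)) map_cat flatten_cat.
  congr (_ ++ _); rewrite (drop_nth i) ?size_enum_ord //=.
  by rewrite nth_ord_enum.
- by rewrite mem_blk.
- move=> s; rewrite inE => /andP[/forallP/(_ i)].
  rewrite leqnn => /= /subsetP s0 _; apply/subsetP => x.
  rewrite in_setI blkS => /andP[xs /eqP e]; rewrite inE.
  case: x e xs => j x /= e; subst j => xs.
  by have := s0 x; rewrite !inE => /(_ xs)/eqP->.
- move=> s; rewrite inE => /andP[/forallP si _]; apply/subsetP => x xs.
  by rewrite blkS (implyP (si x)).
move=> s; set B := [set x in blk i].
have sB : (s :&: B \in faces (block_complex i)) = (slice s i \in faces (L i)).
  rewrite inE; have -> : slice (s :&: B) i = slice s i.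
    by apply/setP => x; rewrite !inE mem_blk eqxx andbT.
  have -> : [forall x in s :&: B, tag x == i]; last by [].
  by apply/forallP => x; apply/implyP; rewrite in_setI blkS => /andP[].
(* [s'] collapses the block to nothing if its slice lies in [L i] and to [pt i] otherwise, so [s']
   at stage [i] and [s] at stage [i.+1] have the same support. *)
rewrite sB; set s' := (_ :|: _).
have slice_ne j : j != i -> slice s' j = slice s j.
  move=> ji; apply/setP => x; rewrite !inE mem_blk /= (negPf ji) /=.
  case: ifP; rewrite inE ?orbF //; case: eqP => [e|]; rewrite ?orbF //.
  by case/eqP: ji; apply: (congr1 tag e).
have slice_eq : slice s' i = if slice s i \in faces (L i) then set0 else [set ord0].
  apply/setP => x; rewrite !inE mem_blk eqxx /=.
  by case: ifP; rewrite !inE // eq_Tagged.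
have supE : support_set i s' = support_set i.+1 s.
  apply/setP => j; rewrite !inE ltnS; case: (eqVneq j i) => [->|ji].
    rewrite ltnn leqnn slice_eq; case: ifP => _; rewrite ?eqxx //.
    by apply/eqP => /setP/(_ ord0); rewrite !inE eqxx.
  by rewrite slice_ne // ltn_neqAle ji.
rewrite !inE supE; congr (_ && _); apply/forallP/forallP => h j; apply/implyP.
  case: (eqVneq j i) => [->|ji ij].
    by rewrite slice_eq; case: ifP; rewrite ?sub0set ?subxx.
  by rewrite slice_ne // (implyP (h j)) // ltn_neqAle eq_sym ji.
move=> ij; have ji : j != i by rewrite -val_eqE neq_ltn ij orbT.
by rewrite -slice_ne // (implyP (h j)) // ltnW.
Qed.

Lemma redcoh_stage r : (r <= m)%N -> steenrod_iso (redcoh (stage r))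
  (foldl tens (iter r susp (redcoh K)) [seq redcoh (L i) | i <- take r (enum 'I_m)]).
Proof.
have gL i : graded (redcoh (L i)) by apply: graded_redcoh.
elim: r => [_|r IH rm]; first by rewrite take0; apply/steenrod_iso_sym/redcoh_stage0.
have gr k : graded (iter k susp (redcoh K)).
  by elim: k => [|k IHk] /=; [apply: graded_redcoh | apply: graded_susp].
rewrite (take_nth (Ordinal rm)) ?size_enum_ord //.
have -> : nth (Ordinal rm) (enum 'I_m) r = Ordinal rm.
  exact: (nth_ord_enum (Ordinal rm) (Ordinal rm)).
apply: steenrod_iso_trans (redcoh_stageS (Ordinal rm)) _.
(* The suspension gained in this step is moved from the whole product onto its first factor. *)
apply: steenrod_iso_trans (foldl_susp gL _ (gr r)).
apply: steenrod_iso_susp; rewrite map_rcons foldl_rcons.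
apply: steenrod_iso_tens; try exact: graded_redcoh.
- by apply: graded_foldl.
- exact: IH (ltnW rm).
- exact/steenrod_iso_sym/redcoh_block.
Qed.
End Stages.

Theorem proposition6p1p1 (m : nat) (K : complex 'I_m) (l : 'I_m -> nat)
    (L : forall i : 'I_m, complex 'I_(l i).+1) :
  steenrod_iso (redcoh (composition K L))
    (foldl tens (iter m susp (redcoh K)) [seq redcoh (L i) | i <- enum 'I_m]).
Proof.
apply: steenrod_iso_trans (redcoh_stage_last K L) _.
by have := redcoh_stage K L (leqnn m); rewrite take_oversize ?size_enum_ord.
Qed.
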